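(* Assume $u:(0,\infty)\to[0,\infty)$ is nonincreasing, and write $u(0+):=\lim_{x\downarrow 0}u(x)\in[0,\infty]$. Then the problem of maximizing $J(\tau)=\int_0^\infty w(\mathbf{P}(u(S_\tau)>x))\,\mathrm{d}x$ over $\tau\in\mathcal{T}$ has the optimal value $\sup_{\tau\in\mathcal{T}}J(\tau)=u(0+)$, and $$\lim_{T\to+\infty}J(T)=\sup_{\tau\in\mathcal{T}}J(\tau),$$ where $J(T)$ is the value of $J$ at the deterministic time $\tau\equiv T$. Moreover, if $u(\ell)=u(0+)$ for some $\ell>0$, then $\tau_\ell:=\inf\{t\geq 0: S_t\leq \ell\}$ is an optimal stopping time, i.e. $\tau_\ell\in\mathcal{T}$ and $J(\tau_\ell)=\sup_{\tau\in\mathcal{T}}J(\tau)$. If $u(\ell)<u(0+)$ for every $\ell>0$, then the problem has no optimal solution.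
   Context: Let $\{B_t\}_{t\ge0}$ be a standard one-dimensional Brownian motion on a filtered probability space $(\Omega,\mathcal{F},\{\mathcal{F}_t\}_{t\geq0},\mathbf{P})$, let $\sigma>0$ and $\beta\neq0$ be real constants, and let $\{S_t\}_{t\ge0}$ solve $\mathrm{d}S_t=\beta\sigma S_t\,\mathrm{d}B_t$, $S_0=s>0$. $\mathcal{T}$ is the set of all $\{\mathcal{F}_t\}$-stopping times $\tau$ with $\mathbf{P}(\tau<+\infty)=1$. The function $w:[0,1]\to[0,1]$ (probability distortion) is strictly increasing and absolutely continuous with $w(0)=0$, $w(1)=1$. The function $u$ is of the form $u(x)=U(x^{1/\beta})$, $x\in(0,\infty)$, where $U:[0,\infty)\to[0,\infty)$ is nondecreasing and continuous.
   Formalization: ''Optimal'' is taken to require a finite optimal value, so the final no-optimal-solution claim is proved only for u(0+) finite; when u(0+) is infinite, some stopping time always attains J = +∞ (e.g. w = id, u(x) = 1/x), so the literal claim fails there. *)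

(* Defs.v *)
From HB Require Import structures.
From mathcomp Require Export all_boot all_order all_algebra.
From mathcomp Require Export all_classical all_reals all_analysis.

Set Implicit Arguments.
Unset Strict Implicit.
Unset Printing Implicit Defensive.

Import Order.TTheory GRing.Theory Num.Theory.
Import numFieldNormedType.Exports.

Local Open Scope classical_set_scope.
Local Open Scope ring_scope.

(* Time is the half-line [0, +oo[ of R: families indexed by R are only
   constrained at, and only used at, nonnegative indices. *)

Section processes.
Context {R : realType} {d : measure_display} {Omega : measurableType d}.
Variable P : probability Omega R.

Record is_filtration (F : R -> set (set Omega)) : Prop := IsFiltration {
  filtration_sigma_algebra : forall t : R, 0 <= t -> sigma_algebra setT (F t) ;
  filtration_measurable : forall t : R, 0 <= t -> F t `<=` measurable ;
  filtration_nondecreasing : forall r t : R, 0 <= r -> r <= t -> F r `<=` F t }.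

Definition measurable_wrt (G : set (set Omega)) (X : Omega -> R) : Prop :=
  forall Y : set R, measurable Y -> G (X @^-1` Y).

Definition adapted (F : R -> set (set Omega)) (X : R -> Omega -> R) : Prop :=
  forall t : R, 0 <= t -> measurable_wrt (F t) (X t).

Definition continuous_paths (X : R -> Omega -> R) : Prop :=
  forall omega, {within `[0, +oo[, continuous (X ^~ omega)}.

(* The second argument of [normal_prob] is the standard deviation. *)
Record is_brownian_motion (F : R -> set (set Omega)) (B : R -> Omega -> R)
    : Prop := IsBrownianMotion {
  brownian_adapted : adapted F B ;
  brownian_continuous : continuous_paths B ;
  brownian_start : P [set omega | B 0 omega = 0] = 1%E ;
  brownian_gaussian : forall (r t : R) (Y : set R), 0 <= r -> r < t ->
    measurable Y ->
    P [set omega | Y (B t omega - B r omega)] =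
      normal_prob 0 (Num.sqrt (t - r)) Y ;
  brownian_independent : forall (r t : R) (A : set Omega) (Y : set R),
    0 <= r -> r < t -> F r A -> measurable Y ->
    P (A `&` [set omega | Y (B t omega - B r omega)]) =
      (P A * P [set omega | Y (B t omega - B r omega)%R])%E }.

(* Step process \sum_(i < n) xi_i 1_[t_i, t_(i+1)[ along a subdivision
   0 = t_0 <= ... <= t_n = T of [0, T], with xi_i measurable w.r.t. F t_i. *)
Record step_process (F : R -> set (set Omega)) (T : R) := StepProcess {
  step_size : nat ;
  step_time : nat -> R ;
  step_coef : nat -> Omega -> R ;
  step_time0 : step_time 0%N = 0 ;
  step_timeT : step_time step_size = T ;
  step_time_le : forall i, (i < step_size)%N ->
    step_time i <= step_time i.+1 ;
  step_coef_measurable : forall i, (i < step_size)%N ->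
    measurable_wrt (F (step_time i)) (step_coef i) }.

Definition step_value (F : R -> set (set Omega)) (T : R)
    (h : step_process F T) (r : R) (omega : Omega) : R :=
  \sum_(i < step_size h)
    step_coef h i omega * \1_`[step_time h i, step_time h i.+1[ r.

Definition step_integral (F : R -> set (set Omega)) (T : R)
    (h : step_process F T) (B : R -> Omega -> R) (omega : Omega) : R :=
  \sum_(i < step_size h)
    step_coef h i omega *
    (B (step_time h i.+1) omega - B (step_time h i) omega).

(* X is a version of the Ito integral \int_0^T H dB, for an adapted H with
   continuous paths: there are step processes h_n such that
   \int_0^T |h_n - H|^2 dr --> 0 in probability, and X is the limit in
   probability of the elementary integrals \int_0^T h_n dB. *)
Definition is_ito_integral (F : R -> set (set Omega)) (B : R -> Omega -> R)
    (H : R -> Omega -> R) (T : R) (X : Omega -> R) : Prop :=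
  exists h : nat -> step_process F T,
    (forall eps : R, 0 < eps ->
      P [set omega | (eps%:E <= \int[lebesgue_measure]_(r in `[0%R, T])
            ((step_value (h n) r omega - H r omega) ^+ 2)%R%:E)%E]
        @[n --> \oo] --> 0%E) /\
    (forall eps : R, 0 < eps ->
      P [set omega | eps <= `|step_integral (h n) B omega - X omega|]
        @[n --> \oo] --> 0%E).

(* dS_t = a S_t dB_t, S_0 = s *)
Record solves_linear_sde (F : R -> set (set Omega)) (B : R -> Omega -> R)
    (a s : R) (S : R -> Omega -> R) : Prop := SolvesLinearSde {
  sde_adapted : adapted F S ;
  sde_continuous : continuous_paths S ;
  sde_start : P [set omega | S 0 omega = s] = 1%E ;
  sde_integral : forall t : R, 0 <= t ->
    is_ito_integral F B (fun r omega => a * S r omega) t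
      (fun omega => S t omega - s) }.

(* Almost surely finite stopping times; tau may take the value +oo. *)
Definition stopping_times (F : R -> set (set Omega)) : set (Omega -> \bar R) :=
  [set tau | [/\ forall omega, (0 <= tau omega)%E,
    forall t : R, 0 <= t -> F t [set omega | (tau omega <= t%:E)%E] &
    P [set omega | (tau omega < +oo)%E] = 1%E]].

(* The value of S at tau; on the event tau = +oo, null for the stopping times
   above, this is S 0. *)
Definition stopped (S : R -> Omega -> R) (tau : Omega -> \bar R)
    (omega : Omega) : R :=
  S (fine (tau omega)) omega.

Definition objective (w u : R -> R) (S : R -> Omega -> R)
    (tau : Omega -> \bar R) : \bar R :=
  (\int[lebesgue_measure]_(x in `[0%R, +oo[)
     (w (fine (P [set omega | (x < u (stopped S tau omega))%R])))%:E)%E.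

Definition optimal_value (F : R -> set (set Omega)) (w u : R -> R)
    (S : R -> Omega -> R) : \bar R :=
  ereal_sup [set objective w u S tau | tau in stopping_times F].

(* An optimal solution attains a finite optimal value: a problem with infinite
   value is ill-posed and has no optimal solution, even though some tau may
   then have infinite objective (e.g. w = id, u x = x^-1). *)
Definition optimal_stopping (F : R -> set (set Omega)) (w u : R -> R)
    (S : R -> Omega -> R) (tau : Omega -> \bar R) : Prop :=
  [/\ stopping_times F tau,
      objective w u S tau = optimal_value F w u S &
      (optimal_value F w u S < +oo)%E].

Definition hitting_time (S : R -> Omega -> R) (l : R) (omega : Omega)
    : \bar R :=
  ereal_inf [set t%:E | t in [set t : R | 0 <= t /\ S t omega <= l]].

End processes.

Section real_functions.
Context {R : realType}.

Definition absolutely_continuous_on (a b : R) (f : R -> R) : Prop :=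
  forall eps : R, 0 < eps -> exists2 delta : R, 0 < delta &
    forall (n : nat) (x y : nat -> R),
      (forall i, (i < n)%N -> [/\ a <= x i, x i <= y i & y i <= b]) ->
      trivIset `I_n (fun i => `]x i, y i[%classic) ->
      \sum_(i < n) (y i - x i) < delta ->
      \sum_(i < n) `|f (y i) - f (x i)| < eps.

Record is_distortion (w : R -> R) : Prop := IsDistortion {
  distortion_range : forall p : R, 0 <= p <= 1 -> 0 <= w p <= 1 ;
  distortion_increasing : {in `[0, 1] &, {homo w : p q / p < q}} ;
  distortion_absolutely_continuous : absolutely_continuous_on 0 1 w ;
  distortion0 : w 0 = 0 ;
  distortion1 : w 1 = 1 }.

(* U is only relevant on [0, +oo[. *)
Record is_payoff (U : R -> R) : Prop := IsPayoff {
  payoff_ge0 : forall x : R, 0 <= x -> 0 <= U x ;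
  payoff_nondecreasing : {in `[0, +oo[ &, {homo U : x y / x <= y}} ;
  payoff_continuous : {within `[0, +oo[, continuous U} }.

(* Only meaningful for 0 < x; S is almost surely positive. *)
Definition transformed_payoff (U : R -> R) (beta x : R) : R :=
  U (x `^ beta^-1).

Definition right_limit0 (u : R -> R) : \bar R :=
  lim ((u x)%:E @[x --> 0^'+]).

End real_functions.

(* Main.v *)
Require Import Defs.
From HB Require Import structures.
From mathcomp Require Import measurable_realfun ring lra.

(* Since u is nonincreasing and J only involves the law of u(S_tau), the bound
   J(tau) <= u(0+) is immediate, and it is strict when u < u(0+) everywhere and
   u(0+) is finite. The rest follows from P(0 < S_T <= l) --> 1 for every
   l > 0: it makes J(T) exceed any c < u(0+), and makes tau_l almost surely
   finite, with S_(tau_l) = min(s, l) by path continuity.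

   That limit comes from S_T = s E_T, where E_t = exp(a B_t - a^2 t / 2) and
   a = beta sigma, together with Chebyshev's inequality for B_T. To obtain
   S = s E from the definition of the Ito integral, put D = S - s E. A Lenglart
   inequality for step processes turns the equation of S into: S_T - s is
   approximated in probability by sums of a S_(t_i) (B_(t_(i+1)) - B_(t_i)) over
   grids of arbitrarily small mesh; the same holds for E with errors that are
   orthogonal Gaussian functionals of variance O((t_(i+1) - t_i)^2). Hence
   D_T is close to a discrete martingale, and on the paths bounded by K up to
   time t, f(t) = E[D_t^2] is bounded by a multiple of the integral of f over
   [0, t]. Iterating this Gronwall inequality gives f(t) <= C (c t)^m / m! for
   all m, so f = 0. *)

Set Implicit Arguments.
Unset Strict Implicit.
Unset Printing Implicit Defensive.

Import Order.TTheory GRing.Theory Num.Theory.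
Import numFieldNormedType.Exports.

Local Open Scope classical_set_scope.
Local Open Scope ring_scope.

(** * Gaussian integrals *)

Section gaussian.
Context {R : realType}.
Local Notation mu := (@lebesgue_measure R).

(** The equation gives no moment bound on [S]: its Ito integral is only a limit in probability of
    integrals of unspecified step processes. Two devices make second moments available. Lenglart's
    inequality turns a bound in probability on a quadratic sum into one on the martingale sum, so
    the step processes can be exchanged for values of [S] on a grid. Then everything is multiplied
    by the indicator that [S] and E have stayed below [K] so far; this event lies in [F t] and
    shrinks as t grows, so the killed coefficients stay adapted and agree with the original ones on
    the final event. E is compared with its own increments over the grid, which reduces Ito's
    formula to the mean and variance of one function of a Gaussian variable. The Gronwall iteration
    never integrates f in time, which would call for its measurability: it carries an explicit power
    of t through left Riemann sums. Constants such as 2 e^8 come from one crude growth estimate;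
    only their scaling in the time step matters. *)

Lemma ge0_integral_normal_prob (m sigma : R) (f : R -> \bar R) :
  measurable_fun setT f -> (forall x, (0 <= f x)%E) ->
  (\int[normal_prob m sigma]_x f x =
   \int[mu]_x (f x * (normal_pdf m sigma x)%:E))%E.
Proof.
move=> mf f0.
have dom := @normal_prob_dominates R m sigma.
rewrite -(Radon_Nikodym_SigmaFinite.change_of_variables dom)//.
have mrn := measurable_int _ (Radon_Nikodym_SigmaFinite.f_integrable dom).
apply: ae_eq_integral => //.
- exact: emeasurable_funM.
- apply: emeasurable_funM => //; apply/measurable_EFinP.
  exact: measurable_normal_pdf.
(* The Radon-Nikodym derivative is determined only up to null sets; it agrees a.e. with [normal_pdf]
   because both have the same integral over every measurable set. *)
- apply: ae_eqe_mul2l.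
  apply: integral_ae_eq => //.
  + exact: Radon_Nikodym_SigmaFinite.f_integrable.
  + by apply/measurable_EFinP; exact: measurable_normal_pdf.
  + by move=> E _ mE; rewrite -(Radon_Nikodym_SigmaFinite.f_integral dom).
Qed.

(** Completing the square: exp(c x) times the centred density is a constant times the density of
    mean [c * sigma ^+ 2]. *)
Lemma normal_prob_mgf (sigma c : R) : 0 < sigma ->
  (\int[normal_prob 0 sigma]_x (expR (c * x))%:E =
   (expR (c ^+ 2 * sigma ^+ 2 / 2))%:E)%E.
Proof.
move=> s0; have s0' : sigma != 0 by rewrite gt_eqF.
rewrite ge0_integral_normal_prob; last 2 first.
- by apply/measurable_EFinP; apply: measurableT_comp => //;
    exact: measurable_funM.
- by move=> x; rewrite lee_fin expR_ge0.
transitivity (\int[mu]_x ((expR (c ^+ 2 * sigma ^+ 2 / 2))%:E *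
    (normal_pdf (c * sigma ^+ 2) sigma x)%:E))%E.
  apply: eq_integral => x _; rewrite -!EFinM !normal_pdfE//; congr EFin.
  rewrite mulrCA [RHS]mulrCA; congr (_ * _); rewrite /normal_fun -!expRD.
  by congr expR; field.
rewrite integralZl//; last exact: integrable_normal_pdf.
by rewrite integral_normal_pdf mule1.
Qed.

Lemma expR_norm_le (y : R) : expR `|y| <= expR y + expR (- y).
Proof.
by case: (ger0P y) => _; rewrite ?lerDl ?lerDr ?expR_ge0//.
Qed.

Lemma le_expRB1 (y : R) : `|expR y - 1| <= `|y| * expR `|y|.
Proof.
have h (z : R) : 1 - expR z <= - z by have := expR_ge1Dx z; lra.
case: (ger0P y) => y0.
  have e1 : 1 <= expR y by rewrite -[leLHS](@expR0 R) ler_expR.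
  rewrite ger0_norm ?subr_ge0//.
  have := h (- y); rewrite expRN opprK => hy.
  have ey := expR_gt0 y.
  have ee : (expR y)^-1 * expR y = 1 by rewrite mulVf ?gt_eqF.
  by have := ler_wpM2r (ltW ey) hy; lra.
have e1 : expR y <= 1 by rewrite -[leRHS](@expR0 R) ler_expR ltW.
rewrite ler0_norm ?subr_le0// opprB (le_trans (h y))// ler_peMr ?oppr_ge0 ?ltW//.
by rewrite expR_gt1 oppr_gt0.
Qed.

(** The inequality 1 + x <= exp x, used at y and at -y, places the remainder between 0 and y (exp y
    - 1). *)
Lemma expR_taylor1 (y : R) : `|expR y - 1 - y| <= y ^+ 2 * expR `|y|.
Proof.
have h0 : 0 <= expR y - 1 - y by have := expR_ge1Dx y; lra.
have h1 : expR y - 1 - y <= y * (expR y - 1).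
  have := expR_ge1Dx (- y); rewrite expRN => hy.
  have ey := expR_gt0 y.
  have ee : (expR y)^-1 * expR y = 1 by rewrite mulVf ?gt_eqF.
  by have := ler_wpM2r (ltW ey) hy; lra.
rewrite ger0_norm// (le_trans h1)// (le_trans (ler_norm _))// normrM.
by rewrite -real_normK ?num_real// expr2 -mulrA ler_wpM2l// le_expRB1.
Qed.

(* Growth at most [exp (2 |x| / sigma)] is all that is used of the integrands
   below; it makes the constants scale correctly in [sigma]. *)
Lemma normal_prob_expR_growth (sigma A : R) (phi : R -> R) : 0 < sigma -> 0 <= A ->
  measurable_fun setT phi ->
  (forall x, `|phi x| <= A * expR (2 * (`|x| / sigma))) ->
  (\int[normal_prob 0 sigma]_x ((phi x) ^+ 2)%:E <=
    (A ^+ 2 * (2 * expR 8))%:E)%E.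
Proof.
move=> s0 A0 mphi hphi; have s0' : sigma != 0 by rewrite gt_eqF.
have me (c : R) : measurable_fun setT (fun x : R => expR (c * x)).
  by apply: measurableT_comp => //; exact: measurable_funM.
apply: (@le_trans _ _ (\int[normal_prob 0 sigma]_x
   ((A ^+ 2)%:E * ((expR (4 / sigma * x))%:E + (expR (- (4 / sigma) * x))%:E)))%E).
  apply: ge0_le_integral => //.
  - by move=> x _; rewrite lee_fin sqr_ge0.
  - by apply/measurable_EFinP; exact: measurable_funX.
  - apply: emeasurable_funM => //; apply: emeasurable_funD;
      by apply/measurable_EFinP; exact: me.
  - move=> x _; rewrite -EFinD -EFinM lee_fin -real_normK ?num_real//.
    apply: (@le_trans _ _ ((A * expR (2 * (`|x| / sigma))) ^+ 2)).
      by rewrite lerXn2r// ?nnegrE ?mulr_ge0 ?expR_ge0.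
    rewrite exprMn ler_wpM2l ?sqr_ge0// -expRM_natl.
    have -> : 2%N%:R * (2 * (`|x| / sigma)) = `|4 / sigma * x|.
      by rewrite normrM ger0_norm ?divr_ge0 ?ltW//; field.
    by rewrite mulNr expR_norm_le.
rewrite ge0_integralZl_EFin//; last 3 first.
- by move=> x _; rewrite -EFinD lee_fin addr_ge0 ?expR_ge0.
- by apply: emeasurable_funD; apply/measurable_EFinP; exact: me.
- exact: sqr_ge0.
rewrite ge0_integralD//; try by apply/measurable_EFinP; exact: me.
(* Squaring the growth bound turns the rate 2 / sigma into 4 / sigma, and 8 is (4 / sigma)^2 sigma^2
   / 2. *)
rewrite !normal_prob_mgf// -EFinD -EFinM lee_fin ler_wpM2l ?sqr_ge0//.
rewrite sqrrN (_ : _ / 2 = 8); last by field.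
by rewrite mulr_natl mulr2n.
Qed.

Lemma integrable_sqr_fin (d : measure_display) (T : measurableType d)
    (m : probability T R) (phi : T -> R) (v : R) :
  measurable_fun setT phi ->
  (\int[m]_x ((phi x) ^+ 2)%:E <= v%:E)%E ->
  m.-integrable setT (EFin \o phi) /\
  m.-integrable setT (fun x => ((phi x) ^+ 2)%:E).
Proof.
move=> mphi hv.
have i2 : m.-integrable setT (fun x => ((phi x) ^+ 2)%:E).
  apply/integrableP; split.
    by apply/measurable_EFinP; exact: measurable_funX.
  under eq_integral do rewrite gee0_abs ?lee_fin ?sqr_ge0//.
  by rewrite (le_lt_trans hv)// ltry.
split => //.
apply: (@le_integrable _ _ _ _ _ _ _ (fun x => 1%:E + ((phi x) ^+ 2)%:E)%E) => //.
- by apply/measurable_EFinP.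
- move=> x _; rewrite /= lee_fin [leRHS]ger0_norm ?addr_ge0 ?sqr_ge0//.
  rewrite -(real_normK (num_real (phi x))); have := normr_ge0 (phi x).
  by move: `|_| => y y0; nra.
- apply: integrableD => //; exact: finite_measure_integrable_cst.
Qed.

Lemma integral_probability_cst (d : measure_display) (T : measurableType d)
    (m : probability T R) (c : R) :
  (\int[m]_x c%:E = c%:E)%E.
Proof.
rewrite integral_cst// -[RHS]mule1; congr (_ * _)%E.
exact: probability_setT.
Qed.

(** Integrating 1 + c x <= exp(c x) bounds c times the mean by exp(c^2 sigma^2 / 2) - 1, which is
    O(c^2); letting c tend to 0 from both sides forces the mean to vanish. *)
Lemma normal_prob_mean0 (sigma : R) : 0 < sigma ->
  (\int[normal_prob 0 sigma]_x x%:E = 0)%E.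
Proof.
move=> s0; have s0' : sigma != 0 by rewrite gt_eqF.
have grow (x : R) : `|x| <= sigma * expR (2 * (`|x| / sigma)).
  have := expR_ge1Dx (2 * (`|x| / sigma)).
  have h0 : 0 <= `|x| / sigma by rewrite divr_ge0 // ltW.
  move=> h; rewrite -ler_pdivrMl// mulrC.
  by rewrite (le_trans _ h)//; lra.
have [ix _] := integrable_sqr_fin (m := normal_prob 0 sigma) (phi := id) (@measurable_id _ _ _)
  (normal_prob_expR_growth (phi := id) s0 (ltW s0) (@measurable_id _ _ _) grow).
have fin : (\int[normal_prob 0 sigma]_x x%:E)%E \is a fin_num.
  exact: (integrable_fin_num measurableT ix).
set I := (X in X = _); rewrite -/I in fin.
have key (c : R) : (c * fine I <= expR (c ^+ 2 * sigma ^+ 2 / 2) - 1).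
  have : (\int[normal_prob 0 sigma]_x (1%:E + c%:E * x%:E) <=
          \int[normal_prob 0 sigma]_x (expR (c * x))%:E)%E.
    apply: le_integral => //.
    - apply: integrableD => //; first exact: finite_measure_integrable_cst.
      exact: integrableZl.
    - apply/integrableP; split.
        by apply/measurable_EFinP; apply: measurableT_comp => //;
          exact: measurable_funM.
      under eq_integral do rewrite gee0_abs ?lee_fin ?expR_ge0//.
      by rewrite normal_prob_mgf// ltry.
    - by move=> x _; rewrite -EFinM -EFinD lee_fin expR_ge1Dx.
  rewrite normal_prob_mgf// integralD//; last 2 first.
  - exact: finite_measure_integrable_cst.
  - exact: integrableZl.
  rewrite integral_probability_cst integralZl//.
  by rewrite -/I -(fineK fin) -EFinM -EFinD lee_fin; lra.
pose q := sigma ^+ 2 / 2.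
have q0 : 0 < q by rewrite divr_gt0 ?exprn_gt0.
have small (y : R) : 0 <= y -> y <= 2^-1 -> expR y - 1 <= 2 * y.
  move=> y0 y1; have := expR_ge1Dx (- y); rewrite expRN => hy.
  have ey := expR_gt0 y.
  have ee : (expR y)^-1 * expR y = 1 by rewrite mulVf ?gt_eqF.
  by have := ler_wpM2r (ltW ey) hy; nra.
have abs0 : forall c : R, 0 < c -> c ^+ 2 * q <= 2^-1 -> `|fine I| <= 2 * c * q.
  move=> c c0 cq; have c2 : 0 <= c ^+ 2 * q by rewrite mulr_ge0 ?sqr_ge0 ?ltW.
  have h1 := key c; have h2 := key (- c); have h3 := small _ c2 cq.
  rewrite sqrrN -mulrA in h2; rewrite -mulrA in h1.
  rewrite ler_norml; apply/andP; split;
    by rewrite -(ler_pM2l c0); nra.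
rewrite -(fineK fin); congr EFin; apply/eqP; rewrite -normr_eq0.
apply/negPn/negP => I0; have {}I0 : 0 < `|fine I| by rewrite lt_def I0/=.
(* The first entry makes the bound [2 * c * q] at most half of |I|, a contradiction; the other two
   ensure c^2 q <= 1/2. *)
pose c := Num.min (`|fine I| / (4 * q)) (Num.min 1 (q^-1 / 2)).
have c0 : 0 < c.
  by rewrite !lt_min ltr01 !divr_gt0 ?mulr_gt0 ?invr_gt0.
have c1 : c <= 1 by rewrite /c !ge_min lexx/= orbT.
have c2 : c <= q^-1 / 2 by rewrite /c !ge_min lexx !orbT.
have c3 : c <= `|fine I| / (4 * q) by rewrite /c !ge_min lexx.
have cq : c ^+ 2 * q <= 2^-1.
  have : c * q <= 2^-1.
    by rewrite -ler_pdivlMr// mulrC.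
  have : 0 <= c * q by rewrite mulr_ge0 ?ltW.
  by nra.
have := abs0 c c0 cq.
rewrite ler_pdivlMr ?mulr_gt0// in c3; nra.
Qed.

(** The growth estimate with [A = sigma]. The true value is sigma^2; the factor 2 e^8 is the price
    of treating x and [expR_defect] alike. *)
Lemma normal_prob_variance_le (sigma : R) : 0 < sigma ->
  (\int[normal_prob 0 sigma]_x (x ^+ 2)%:E <=
    (2 * expR 8 * sigma ^+ 2)%:E)%E.
Proof.
move=> s0; have s0' : sigma != 0 by rewrite gt_eqF.
rewrite [X in X%:E](_ : _ = sigma ^+ 2 * (2 * expR 8)); last by rewrite mulrC.
apply: normal_prob_expR_growth => //; first exact: ltW.
move=> x; have := expR_ge1Dx (2 * (`|x| / sigma)).
have h0 : 0 <= `|x| / sigma by rewrite divr_ge0 // ltW.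
move=> h; rewrite -ler_pdivrMl// mulrC.
by rewrite (le_trans _ h)//; lra.
Qed.

(* One-step error between the increment of [expR (a B_t - a^2 t / 2)],
   divided by its initial value, and that of [a B_t]; [v] is the length of the
   time step. *)
Definition expR_defect (a v x : R) : R :=
  expR (a * x - a ^+ 2 * v / 2) - 1 - a * x.

Lemma measurable_expR_defect (a v : R) : measurable_fun setT (expR_defect a v).
Proof.
apply: measurable_funB; last exact: measurable_funM.
apply: measurable_funB => //; apply: measurableT_comp => //.
by apply: measurable_funB => //; exact: measurable_funM.
Qed.

(** Write c = a^2 sigma^2 and p = |x| / sigma. Since c <= 1, |a x| <= p. The Taylor remainder at a x
    is at most c p^2 e^p <= 4 c e^(2p), and the correction by exp(-c/2) costs at most c e^p; hence
    the 5. *)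
Lemma expR_defect_growth (a sigma x : R) : 0 < sigma ->
  a ^+ 2 * sigma ^+ 2 <= 1 ->
  `|expR_defect a (sigma ^+ 2) x| <=
    5 * (a ^+ 2 * sigma ^+ 2) * expR (2 * (`|x| / sigma)).
Proof.
move=> s0; rewrite /expR_defect; set c := a ^+ 2 * sigma ^+ 2 => c1.
have s0' : sigma != 0 by rewrite gt_eqF.
set p := `|x| / sigma.
have p0 : 0 <= p by rewrite divr_ge0 // ltW.
have c0 : 0 <= c by rewrite mulr_ge0 ?sqr_ge0.
set y := a * x.
have ysq : y ^+ 2 = c * p ^+ 2.
  by rewrite /y /c /p expr_div_n real_normK ?num_real//; field.
have yp : `|y| <= p.
  rewrite -(@ler_pXn2r _ 2)// ?nnegrE// real_normK ?num_real// ysq.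
  by rewrite ler_piMl ?sqr_ge0.
have e1 : expR `|y| <= expR p by rewrite ler_expR.
have e2 : expR y <= expR p by rewrite ler_expR (le_trans (ler_norm _)).
have e3 : 1 - expR (- (c / 2)) <= c / 2 by have := expR_ge1Dx (- (c / 2)); lra.
have e4 : 0 <= 1 - expR (- (c / 2)).
  by rewrite subr_ge0 -[leRHS](@expR0 R) ler_expR oppr_le0 divr_ge0.
have e5 : p ^+ 2 <= 4 * expR p.
  have -> : p = 2%N%:R * (p / 2) by field.
  rewrite expRM_natl; have := expR_ge1Dx (p / 2).
  have : 0 <= p / 2 by rewrite divr_ge0.
  by move: (p / 2) (expR _) => r s; nra.
have e6 : 1 <= expR p by rewrite -[leLHS](@expR0 R) ler_expR.
have -> : expR (2 * p) = expR p * expR p by rewrite -expRD; congr expR; ring.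
have -> : expR (y - c / 2) - 1 - y =
   (expR y - 1 - y) - expR y * (1 - expR (- (c / 2))) by rewrite expRD; ring.
rewrite (le_trans (ler_normB _ _))//.
have := expR_taylor1 y; rewrite ysq => t1.
rewrite [X in _ + X]ger0_norm ?mulr_ge0 ?expR_ge0//.
have t2 : c * p ^+ 2 * expR `|y| <= c * (4 * expR p) * expR p.
  by apply: ler_pM => //; [exact: mulr_ge0 c0 (sqr_ge0 p)|rewrite ler_wpM2l].
have t3 : expR y * (1 - expR (- (c / 2))) <= expR p * c.
  by apply: ler_pM => //; rewrite ?expR_ge0//; lra.
have t4 : expR p * c <= c * (expR p * expR p).
  by rewrite mulrC ler_wpM2l// ler_peMr ?expR_ge0.
lra.
Qed.

(** The term a^2 v / 2 in the exponent is exactly the logarithm of the moment generating function at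
    a, so the exponential has mean 1. *)
Lemma expR_defect_mean0 (a sigma : R) : 0 < sigma ->
  a ^+ 2 * sigma ^+ 2 <= 1 ->
  (\int[normal_prob 0 sigma]_x (expR_defect a (sigma ^+ 2) x)%:E = 0)%E.
Proof.
move=> s0 c1; rewrite /expR_defect.
have ix : (normal_prob 0 sigma).-integrable setT (EFin \o @id R).
  by have [] := integrable_sqr_fin (m := normal_prob 0 sigma) (phi := id)
    (@measurable_id _ _ _) (normal_prob_variance_le s0).
have i1 : (normal_prob 0 sigma).-integrable setT (fun _ : R => 1%:E).
  exact: finite_measure_integrable_cst.
have ie : (normal_prob 0 sigma).-integrable setT (fun x : R => (expR (a * x))%:E).
  apply/integrableP; split.
    by apply/measurable_EFinP; apply: measurableT_comp => //;
       exact: measurable_funM.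
  under eq_integral do rewrite gee0_abs ?lee_fin ?expR_ge0//.
  by rewrite normal_prob_mgf// ltry.
set k := a ^+ 2 * sigma ^+ 2 / 2.
transitivity (\int[normal_prob 0 sigma]_x
   ((expR (- k))%:E * (expR (a * x))%:E - 1%:E - a%:E * x%:E))%E.
  apply: eq_integral => x _; rewrite -EFinM -!EFinB; congr EFin.
  by rewrite -expRD (addrC (- k)).
rewrite integralB//; last 2 first.
- by apply: integrableB => //; exact: integrableZl.
- exact: integrableZl.
rewrite integralB//; last exact: integrableZl.
rewrite !integralZl// normal_prob_mgf// normal_prob_mean0//.
rewrite integral_probability_cst mule0 sube0 -EFinM -expRD -/k addNr expR0.
by rewrite subee.
Qed.

Lemma expR_defect_variance_le (a sigma : R) : 0 < sigma ->
  a ^+ 2 * sigma ^+ 2 <= 1 ->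
  (\int[normal_prob 0 sigma]_x (expR_defect a (sigma ^+ 2) x ^+ 2)%:E <=
    (50 * expR 8 * a ^+ 4 * sigma ^+ 4)%:E)%E.
Proof.
move=> s0 c1.
apply: (le_trans (normal_prob_expR_growth s0 _
  (measurable_expR_defect _ _) (fun x => expR_defect_growth x s0 c1))).
  by apply: mulr_ge0 => //; apply: mulr_ge0; exact: sqr_ge0.
by rewrite lee_fin; rewrite le_eqVlt; apply/orP; left; apply/eqP; ring.
Qed.

End gaussian.

(** * Sums of functions of Brownian increments *)

Section measurable_wrt.
Context {R : realType} {d : measure_display} {Omega : measurableType d}.
Implicit Types (G : set (set Omega)) (X : Omega -> R).

(** Moves to the measurable space generated by [G], where the closure lemmas for [measurable_fun]
    apply; generation adds nothing to a sigma-algebra. *)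
Lemma measurable_wrtP G X : sigma_algebra setT G ->
  measurable_wrt G X <->
  measurable_fun setT (X : g_sigma_algebraType G -> R).
Proof.
move=> sG; split.
- move=> h _ Y mY; rewrite setTI; apply: sub_sigma_algebra; exact: h.
- move=> h Y mY; have := h measurableT Y mY.
  by rewrite setTI /measurable/= sigma_algebra_id.
Qed.

Lemma measurable_wrtT G X : G `<=` measurable -> measurable_wrt G X ->
  measurable_fun setT X.
Proof. by move=> mG h _ Y mY; rewrite setTI; apply: mG; exact: h. Qed.

Lemma measurable_wrtS G G' X : G `<=` G' ->
  measurable_wrt G X -> measurable_wrt G' X.
Proof. by move=> GG' h Y mY; apply: GG'; exact: h. Qed.

Lemma measurable_wrt_indic G (A : set Omega) : sigma_algebra setT G -> G A ->
  measurable_wrt G (\1_A : Omega -> R).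
Proof.
move=> sG GA; apply/(measurable_wrtP _ sG).
by apply: measurable_indic; exact: sub_sigma_algebra.
Qed.

End measurable_wrt.

(** * Integrating out an independent increment *)

Section freezing.
Context {R : realType} {d : measure_display} {Omega : measurableType d}.
Variable P : probability Omega R.

(** By independence the law of (X, Z) and the product of the law of [X] with [N] agree on
    rectangles, hence coincide; the rest is Tonelli. *)
Lemma ge0_freezing d' (T : measurableType d') (X : Omega -> T) (Z : Omega -> R)
    (N : probability (measurableTypeR R) R) (g : T * measurableTypeR R -> \bar R) :
  measurable_fun setT X -> measurable_fun setT Z ->
  (forall A Y, measurable A -> measurable Y ->
    P (X @^-1` A `&` Z @^-1` Y) = (P (X @^-1` A) * N Y)%E) ->
  measurable_fun setT g -> (forall x, (0 <= g x)%E) ->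
  (\int[P]_omega g (X omega, Z omega) =
   \int[P]_omega \int[N]_z g (X omega, z))%E.
Proof.
move=> mX mZ indep mg g0.
have mXZ : measurable_fun setT (fun omega => (X omega, (Z omega : measurableTypeR R))).
  exact: measurable_fun_pair.
pose X' : {mfun Omega >-> T} := HB.pack X (isMeasurableFun.Build _ _ _ _ X mX).
pose XZ : {mfun Omega >-> (T * measurableTypeR R)%type} :=
  HB.pack (fun omega : Omega => (X omega, (Z omega : measurableTypeR R)))
    (isMeasurableFun.Build _ _ _ _ _ mXZ).
have -> : (\int[P]_omega g (X omega, Z omega) = \int[distribution P XZ]_y g y)%E.
  by rewrite ge0_integral_distribution.
have -> : (\int[P]_omega \int[N]_z g (X omega, z) =
    \int[distribution P X']_x \int[N]_z g (x, z))%E.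
  rewrite ge0_integral_distribution//.
    exact: measurable_fun_fubini_tonelli_F.
  by move=> x; exact: integral_ge0.
rewrite -(fubini_tonelli1 (m1 := distribution P X') (m2 := N))//.
apply: eq_measure_integral => A mA _.
rewrite -(product_measure_unique (m1 := distribution P X') (m2 := N))// => A1 A2 mA1 mA2.
Qed.

(** With [M] and [k] frozen, the cross term vanishes at each omega because [phi] has mean 0 under
    [N]. The estimate thus holds in [0, +oo], whatever the second moments of [M] and [k]. *)
Lemma sqr_add_indep_increment (G : set (set Omega)) (M k Z : Omega -> R)
    (N : probability (measurableTypeR R) R) (phi : R -> R) (v : R) :
  sigma_algebra setT G -> G `<=` measurable ->
  measurable_wrt G M -> measurable_wrt G k -> measurable_fun setT Z ->
  (forall A Y, G A -> measurable Y ->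
    P (A `&` Z @^-1` Y) = (P A * N Y)%E) ->
  measurable_fun setT phi ->
  (\int[N]_z (phi z)%:E = 0)%E -> (\int[N]_z (phi z ^+ 2)%:E <= v%:E)%E ->
  (\int[P]_omega ((M omega + k omega * phi (Z omega)) ^+ 2)%:E <=
   \int[P]_omega (M omega ^+ 2)%:E + v%:E * \int[P]_omega (k omega ^+ 2)%:E)%E.
Proof.
move=> sG mG hM hk mZ indep mphi phi0 phiv.
have mM := measurable_wrtT mG hM; have mk := measurable_wrtT mG hk.
pose g (x : (R * R) * measurableTypeR R) : \bar R :=
  ((x.1.1 + x.1.2 * phi x.2) ^+ 2)%:E.
have mg : measurable_fun setT g.
  apply/measurable_EFinP; apply: measurable_funX.
  apply: measurable_funD.
    by apply: measurableT_comp; exact: measurable_fst.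
  apply: measurable_funM; last by apply: measurableT_comp.
  by apply: (measurableT_comp measurable_snd); exact: measurable_fst.
have v0 : 0 <= v.
  rewrite -lee_fin (le_trans _ phiv)//; apply: integral_ge0 => z _.
  by rewrite lee_fin sqr_ge0.
have [i1 i2] := integrable_sqr_fin (T := measurableTypeR R) (m := N) mphi phiv.
have -> : (\int[P]_omega ((M omega + k omega * phi (Z omega)) ^+ 2)%:E =
    \int[P]_omega \int[N]_z g ((M omega, k omega), z))%E.
  rewrite -(ge0_freezing (X := fun omega => (M omega, k omega)) (Z := Z))//.
  - exact: measurable_fun_pair.
  - move=> A Y mA mY; apply: indep => //.
    have /(measurable_wrtP _ sG) hM' := hM.
    have /(measurable_wrtP _ sG) hk' := hk.
    have := measurable_fun_pair hM' hk' measurableT mA.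
    by rewrite setTI /measurable/= sigma_algebra_id.
  - by move=> x; rewrite lee_fin sqr_ge0.
rewrite -ge0_integralZl_EFin//; last 2 first.
- by move=> x _; rewrite lee_fin sqr_ge0.
- by apply/measurable_EFinP; exact: measurable_funX.
rewrite -ge0_integralD//; last 4 first.
- by move=> x _; rewrite lee_fin sqr_ge0.
- by apply/measurable_EFinP; exact: measurable_funX.
- by move=> x _; rewrite -EFinM lee_fin mulr_ge0 ?sqr_ge0.
- apply: emeasurable_funM => //.
  by apply/measurable_EFinP; exact: measurable_funX.
apply: ge0_le_integral => //.
- by move=> omega _; apply: integral_ge0 => z _; rewrite lee_fin sqr_ge0.
- have := measurable_fun_fubini_tonelli_F (m2 := N) g mg
    (fun x => _ : (0 <= g x)%E).
  move=> /(_ ltac:(by move=> x; rewrite lee_fin sqr_ge0)) mF.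
  by apply: (measurableT_comp mF); exact: measurable_fun_pair.
- apply: emeasurable_funD.
    by apply/measurable_EFinP; exact: measurable_funX.
  by apply: emeasurable_funM => //; apply/measurable_EFinP; exact: measurable_funX.
move=> omega _; rewrite /g/=.
set m := M omega; set c := k omega.
have -> : (\int[N]_z ((m + c * phi z) ^+ 2)%:E =
    \int[N]_z ((m ^+ 2)%:E + ((2 * m * c)%:E * (phi z)%:E +
      (c ^+ 2)%:E * (phi z ^+ 2)%:E)))%E.
  by apply: eq_integral => z _; rewrite -!EFinM -!EFinD; congr EFin; ring.
have ik : N.-integrable setT (fun _ : R => (m ^+ 2)%:E).
  exact: finite_measure_integrable_cst.
rewrite integralD//; last by apply: integrableD => //; exact: integrableZl.
rewrite integralD//; [|exact: integrableZl|exact: integrableZl].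
rewrite !integralZl// phi0 mule0 add0e integral_probability_cst.
by rewrite leeD2l// muleC lee_wpmul2r// lee_fin sqr_ge0.
Qed.

End freezing.

(** * Discrete Ito isometry *)

Section brownian_sums.
Context {R : realType} {d : measure_display} {Omega : measurableType d}.
Variable P : probability Omega R.
Variables (F : R -> set (set Omega)) (B : R -> Omega -> R).
Hypotheses (hF : is_filtration F) (hB : is_brownian_motion P F B).

Lemma adapted_measurable (X : R -> Omega -> R) t : adapted F X -> 0 <= t ->
  measurable_fun setT (X t).
Proof.
move=> hX t0; apply: (@measurable_wrtT _ _ _ (F t)); last exact: hX.
exact: filtration_measurable hF _ t0.
Qed.

Lemma measurable_increment r t : 0 <= r -> r <= t ->
  measurable_fun setT (fun omega => B t omega - B r omega).
Proof.
move=> r0 rt; apply: measurable_funB; apply: adapted_measurable => //.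
- exact: brownian_adapted hB.
- exact: le_trans rt.
- exact: brownian_adapted hB.
Qed.

Variables (n : nat) (t : nat -> R).
Hypotheses (t0 : t 0%N = 0) (tlt : forall i, (i < n)%N -> t i < t i.+1).

Lemma grid_le i j : (i <= j)%N -> (j <= n)%N -> t i <= t j.
Proof.
elim: j => [|j IH]; first by rewrite leqn0 => /eqP ->.
rewrite leq_eqVlt => /orP[/eqP ->//|ij] jn.
by rewrite (le_trans (IH ij (ltnW jn)))// ltW// tlt.
Qed.

Lemma grid_ge0 i : (i <= n)%N -> 0 <= t i.
Proof. by move=> ni; rewrite -t0 grid_le. Qed.

Variables (k : nat -> Omega -> R) (phi : nat -> R -> R) (v : nat -> R).
Hypothesis hk : forall i, (i < n)%N -> measurable_wrt (F (t i)) (k i).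
Hypothesis mphi : forall i, (i < n)%N -> measurable_fun setT (phi i).

Lemma measurable_wrt_sum_increments j : (j <= n)%N ->
  measurable_wrt (F (t j))
   (fun omega => \sum_(i < j) k i omega * phi i (B (t i.+1) omega - B (t i) omega)).
Proof.
move=> jn.
have sG := filtration_sigma_algebra hF (grid_ge0 jn).
apply/(measurable_wrtP _ sG); apply: measurable_sum => i.
have ij := ltn_ord i; have iltn := leq_trans ij jn.
have adB i' : (i' <= j)%N ->
    measurable_fun setT (B (t i') : g_sigma_algebraType (F (t j)) -> R).
  move=> i'j; apply/(measurable_wrtP _ sG).
  apply: (@measurable_wrtS _ _ _ (F (t i'))).
    apply: filtration_nondecreasing hF _ _ _ _; last exact: grid_le.
    exact: grid_ge0 (leq_trans i'j jn).
  by apply: brownian_adapted hB _ _; exact: grid_ge0 (leq_trans i'j jn).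
apply: measurable_funM.
  apply/(measurable_wrtP _ sG).
  apply: (@measurable_wrtS _ _ _ (F (t i))); last exact: hk.
  apply: filtration_nondecreasing hF _ _ _ _; first exact: grid_ge0 (ltnW iltn).
  exact: grid_le (ltnW ij) jn.
apply: measurableT_comp; first exact: mphi.
by apply: measurable_funB; apply: adB => //; exact: ltnW.
Qed.

Hypothesis phi0 : forall i, (i < n)%N ->
  (\int[normal_prob 0%R (Num.sqrt (t i.+1 - t i)%R)]_z (phi i z)%:E = 0)%E.
Hypothesis phiv : forall i, (i < n)%N ->
  (\int[normal_prob 0%R (Num.sqrt (t i.+1 - t i)%R)]_z (phi i z ^+ 2)%:E <=
   (v i)%:E)%E.

(** Each new summand is a known coefficient times a centred function of an increment independent of
    the past, so second moments add up. The grid is strictly increasing because the normal law is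
    prescribed only for positive time steps. *)
Lemma sum_increments_isometry j : (j <= n)%N ->
  (\int[P]_omega ((\sum_(i < j)
      k i omega * phi i (B (t i.+1) omega - B (t i) omega)) ^+ 2)%:E <=
   \sum_(i < j) (v i)%:E * \int[P]_omega (k i omega ^+ 2)%:E)%E.
Proof.
elim: j => [|j IH] jn.
  rewrite big_ord0; under eq_integral do rewrite big_ord0 expr0n.
  by rewrite integral0.
under eq_integral do rewrite big_ord_recr/=.
rewrite big_ord_recr/=.
have tj := grid_ge0 (ltnW jn).
apply: le_trans; last by apply: leeD; [exact: IH (ltnW jn)|exact: lexx].
apply: (@sqr_add_indep_increment _ _ _ _ (F (t j)) _ _ _
  (normal_prob 0 (Num.sqrt (t j.+1 - t j)))).
- exact: filtration_sigma_algebra hF _ tj.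
- exact: filtration_measurable hF _ tj.
- exact: measurable_wrt_sum_increments (ltnW jn).
- exact: hk.
- by apply: measurable_increment => //; exact: ltW (tlt jn).
- move=> A Y GA mY.
  rewrite (brownian_independent hB tj (tlt jn) GA mY).
  by rewrite (brownian_gaussian hB tj (tlt jn) mY).
- exact: mphi.
- exact: phi0.
- exact: phiv.
Qed.

End brownian_sums.

(** * Lenglart's inequality *)

Section lenglart.
Context {R : realType} {d : measure_display} {Omega : measurableType d}.
Variable P : probability Omega R.

Lemma sqr_chebyshev (Y : Omega -> R) (eps : R) : 0 < eps ->
  measurable_fun setT Y ->
  (P [set omega | (eps <= `|Y omega|)%R] <=
   (eps ^- 2)%:E * \int[P]_omega (Y omega ^+ 2)%:E)%E.
Proof.
move=> eps0 mY; set A := [set omega | _].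
have mA : measurable A.
  rewrite -[A]setTI.
  rewrite (_ : A = (fun omega => `|Y omega|) @^-1` `[eps, +oo[%classic); last first.
    by apply/seteqP; split => x /=; rewrite in_itv/= andbT.
  by apply: (measurableT_comp (@normr_measurable _ setT) mY) => //.
have mY2 : measurable_fun setT (fun omega => (Y omega ^+ 2)%:E).
  by apply/measurable_EFinP; exact: measurable_funX.
rewrite -[leLHS]mul1e -(@mulVf _ (eps ^+ 2)) ?expf_eq0 ?gt_eqF// EFinM -muleA.
rewrite lee_wpmul2l ?lee_fin ?invr_ge0 ?sqr_ge0// -integral_cst//.
apply: (@le_trans _ _ (\int[P]_(omega in A) (Y omega ^+ 2)%:E)%E).
  apply: ge0_le_integral => //.
  - by move=> ? _; rewrite lee_fin sqr_ge0.
  - exact: measurable_funTS.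
  - move=> omega Aomega; rewrite lee_fin -[leRHS]real_normK ?num_real//.
    by rewrite lerXn2r// nnegrE// ltW.
by apply: ge0_subset_integral => // omega _; rewrite lee_fin sqr_ge0.
Qed.

(** Partial sums increase, so the terms kept form an initial segment whose total is itself tested
    against [delta]. *)
Lemma truncated_sum_le (x : nat -> R) (delta : R) n : 0 <= delta ->
  (forall i, 0 <= x i) ->
  \sum_(i < n) (if \sum_(j < i.+1) x j <= delta then x i else 0) <= delta.
Proof.
move=> delta0 x0; elim: n => [|n IH]; first by rewrite big_ord0.
have [h|h] := leP (\sum_(j < n.+1) x j) delta.
  apply: le_trans h; apply: ler_sum => i _; case: ifP => // _.
by rewrite big_ord_recr/= ifF ?addr0//; apply/negbTE; rewrite -ltNge.
Qed.

Variables (F : R -> set (set Omega)) (B : R -> Omega -> R).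
Hypotheses (hF : is_filtration F) (hB : is_brownian_motion P F B).
Variables (n : nat) (t : nat -> R).
Hypotheses (t0 : t 0%N = 0) (tlt : forall i, (i < n)%N -> t i < t i.+1).
Variable k : nat -> Omega -> R.
Hypothesis hk : forall i, (i < n)%N -> measurable_wrt (F (t i)) (k i).

(** The coefficients are cut off once the quadratic sum, including the current term, exceeds
    [delta]. That term is already known at [t i], so the truncated [k'] is adapted and its quadratic
    sum never overshoots; isometry and Chebyshev bound its martingale sum. Where the full quadratic
    sum is at most [delta], nothing was cut. *)
Lemma lenglart (eps delta : R) : 0 < eps -> 0 < delta ->
  (P [set omega | (eps <=
      `|\sum_(i < n) k i omega * (B (t i.+1) omega - B (t i) omega)|)%R] <=
   P [set omega | (delta < \sum_(i < n) k i omega ^+ 2 * (t i.+1 - t i))%R] +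
   (eps ^- 2 * (2 * expR 8 * delta))%:E)%E.
Proof.
move=> eps0 delta0.
have dt i : (i < n)%N -> 0 < t i.+1 - t i by move=> /tlt; rewrite subr_gt0.
(* indices beyond the grid carry junk; they are replaced by 0 *)
pose x i omega : R := if (i < n)%N then k i omega ^+ 2 * (t i.+1 - t i) else 0.
have x0 i omega : 0 <= x i omega.
  rewrite /x; case: ifP => // iltn; rewrite mulr_ge0 ?sqr_ge0//.
  exact/ltW/dt.
pose A i := [set omega | \sum_(j < i.+1) x j omega <= delta].
pose k' i omega := k i omega * \1_(A i) omega.
have mx j i : (j <= i)%N -> (i < n)%N -> measurable_wrt (F (t i)) (x j).
  move=> ji iltn; have ti := grid_ge0 t0 tlt (ltnW iltn).
  have sG := filtration_sigma_algebra hF ti.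
  have jn := leq_ltn_trans ji iltn.
  rewrite /x jn; apply/(measurable_wrtP _ sG).
  apply: measurable_funM => //; apply: measurable_funX.
  apply/(measurable_wrtP _ sG); apply: (@measurable_wrtS _ _ _ (F (t j))).
    apply: (filtration_nondecreasing hF).
      exact: (grid_ge0 t0 tlt (ltnW jn)).
    exact: (grid_le tlt ji (ltnW iltn)).
  exact: hk.
have FA i : (i < n)%N -> F (t i) (A i).
  move=> iltn; have ti := grid_ge0 t0 tlt (ltnW iltn).
  have sG := filtration_sigma_algebra hF ti.
  have : measurable_wrt (F (t i)) (fun omega => \sum_(j < i.+1) x j omega).
    apply/(measurable_wrtP _ sG); apply: measurable_sum => j.
    by apply/(measurable_wrtP _ sG); apply: mx => //; rewrite -ltnS.
  move=> /(_ `]-oo, delta]%classic (measurable_itv _)).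
  by congr (F (t i) _); apply/seteqP; split => omega /=; rewrite in_itv.
have hk' i : (i < n)%N -> measurable_wrt (F (t i)) (k' i).
  move=> iltn; have ti := grid_ge0 t0 tlt (ltnW iltn).
  have sG := filtration_sigma_algebra hF ti.
  apply/(measurable_wrtP _ sG); apply: measurable_funM.
    by apply/(measurable_wrtP _ sG); exact: hk.
  by apply/(measurable_wrtP _ sG); apply: measurable_wrt_indic => //; exact: FA.
have mk i : (i < n)%N -> measurable_fun setT (k i).
  move=> iltn; apply: (measurable_wrtT _ (hk iltn)).
  exact: (filtration_measurable hF (grid_ge0 t0 tlt (ltnW iltn))).
have mk' i : (i < n)%N -> measurable_fun setT (k' i).
  move=> iltn; apply: (measurable_wrtT _ (hk' _ iltn)).
  exact: (filtration_measurable hF (grid_ge0 t0 tlt (ltnW iltn))).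
have mdB i : (i < n)%N ->
    measurable_fun setT (fun omega => B (t i.+1) omega - B (t i) omega).
  move=> iltn; apply: (measurable_increment hF hB).
    exact: (grid_ge0 t0 tlt (ltnW iltn)).
  exact/ltW/tlt.
pose Y (k : nat -> Omega -> R) omega :=
  \sum_(i < n) k i omega * (B (t i.+1) omega - B (t i) omega).
have mY k0 : (forall i, (i < n)%N -> measurable_fun setT (k0 i)) ->
    measurable_fun setT (Y k0).
  move=> mk0; apply: measurable_sum => i; apply: measurable_funM.
    exact: mk0.
  exact: mdB.
have EY : (\int[P]_omega (Y k' omega ^+ 2)%:E <= (2 * expR 8 * delta)%:E)%E.
  have iso := sum_increments_isometry hF hB t0 tlt hk'
    (phi := fun=> id) (v := fun i => 2 * expR 8 * (t i.+1 - t i)).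
  apply: (le_trans (iso _ _ _ n (leqnn n))).
  - by move=> i _; exact: measurable_id.
  - by move=> i iltn; apply: normal_prob_mean0; rewrite sqrtr_gt0 dt.
  - move=> i iltn.
    have := @normal_prob_variance_le R (Num.sqrt (t i.+1 - t i)).
    rewrite sqrtr_gt0 sqr_sqrtr ?(ltW (dt _ iltn))//; apply; exact: dt.
  apply: (@le_trans _ _ (\int[P]_omega
      (\sum_(i < n) (2 * expR 8 * (t i.+1 - t i))%:E * (k' i omega ^+ 2)%:E))%E).
    rewrite ge0_integral_sum//; last 2 first.
    - move=> i; apply: emeasurable_funM => //; apply/measurable_EFinP.
      by apply: measurable_funX; exact: mk'.
    - move=> i omega _; rewrite -EFinM lee_fin mulr_ge0 ?sqr_ge0//.
      by rewrite mulr_ge0 ?ltW ?dt// mulr_gt0// expR_gt0.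
    apply: lee_sum => i _; rewrite ge0_integralZl_EFin//.
    - by move=> ? _; rewrite lee_fin sqr_ge0.
    - by apply/measurable_EFinP; apply: measurable_funX; exact: mk'.
    - by rewrite mulr_ge0 ?ltW ?dt// mulr_gt0// expR_gt0.
  apply: (@le_trans _ _ (\int[P]_omega (2 * expR 8 * delta)%:E)%E); last first.
    by rewrite integral_probability_cst.
  apply: ge0_le_integral => //.
  - move=> omega _; apply: sume_ge0 => i _; rewrite -EFinM lee_fin.
    by rewrite mulr_ge0 ?sqr_ge0// mulr_ge0 ?ltW ?dt// mulr_gt0// expR_gt0.
  - apply: emeasurable_sum => i; apply: emeasurable_funM => //.
    by apply/measurable_EFinP; apply: measurable_funX; exact: mk'.
  - move=> omega _; under eq_bigr do rewrite -EFinM.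
    rewrite sumEFin lee_fin.
    rewrite (_ : \sum_(i < n) _ = 2 * expR 8 * \sum_(i < n)
      (if \sum_(j < i.+1) x j omega <= delta then x i omega else 0)).
      rewrite ler_pM2l ?mulr_gt0 ?expR_gt0//.
      exact: (@truncated_sum_le (x ^~ omega) delta n (ltW delta0) (x0 ^~ omega)).
    rewrite mulr_sumr; apply: eq_bigr => i _; rewrite /k' /x ltn_ord.
    rewrite indicE; case: ifPn => h.
      by rewrite mem_set// mulr1; ring.
    by rewrite memNset ?mulr0 ?expr0n ?mulr0//; exact/negP.
have mQ : measurable_fun setT (fun omega => \sum_(i < n) k i omega ^+ 2 * (t i.+1 - t i)).
  apply: measurable_sum => i; apply: measurable_funM => //.
  by apply: measurable_funX; exact: mk.
set S1 := [set omega | eps <= _]; set S2 := [set omega | delta < _].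
pose S3 := [set omega | eps <= `|Y k' omega|].
have mS2 : measurable S2.
  rewrite -[S2]setTI.
  rewrite (_ : S2 = (fun omega => \sum_(i < n) k i omega ^+ 2 * (t i.+1 - t i))
     @^-1` `]delta, +oo[%classic); last first.
    by apply/seteqP; split => z /=; rewrite in_itv/= andbT.
  exact: mQ.
have mge k0 : (forall i, (i < n)%N -> measurable_fun setT (k0 i)) ->
    measurable [set omega | eps <= `|Y k0 omega|].
  move=> mk0; rewrite -[X in measurable X]setTI.
  rewrite (_ : [set omega | _] =
    (fun omega => `|Y k0 omega|) @^-1` `[eps, +oo[%classic); last first.
    by apply/seteqP; split => z /=; rewrite in_itv/= andbT.
  apply: (measurableT_comp (@normr_measurable _ setT) (mY _ mk0)) => //.
have mS3 : measurable S3 by exact: mge.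
apply: (@le_trans _ _ (P (S2 `|` S3))).
  apply: le_measure; rewrite ?inE//.
  - exact: mge.
  - exact: measurableU.
  - move=> omega /= S1o.
    have [h|h] := ltP delta (\sum_(i < n) k i omega ^+ 2 * (t i.+1 - t i)).
      by left.
    right; rewrite /S3/= (_ : Y k' omega = Y k omega)//.
    apply: eq_bigr => i _; rewrite /k' indicE mem_set ?mulr1//.
    rewrite /A/=; apply: le_trans h.
    rewrite -(big_mkord xpredT (fun i => k i omega ^+ 2 * (t i.+1 - t i))).
    rewrite (big_cat_nat (n := i.+1))//=.
    rewrite -[leLHS]addr0 lerD//.
      rewrite big_mkord; apply: ler_sum => j _.
      by rewrite /x (leq_trans (ltn_ord j)).
    rewrite big_nat_cond; apply: sumr_ge0 => j /andP[/andP[_ jn] _].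
    by rewrite mulr_ge0 ?sqr_ge0//; exact/ltW/dt.
apply: (le_trans (measureU2 _ mS2 mS3)); rewrite leeD2l//.
apply: (le_trans (sqr_chebyshev eps0 (mY _ mk'))).
by rewrite EFinM lee_wpmul2l// lee_fin invr_ge0 sqr_ge0.
Qed.

End lenglart.

(** * Grids *)

Section refinement.
Context {R : realType}.

Record is_grid (T rho : R) (n : nat) (t : nat -> R) : Prop := IsGrid {
  grid_first : t 0%N = 0 ;
  grid_last : t n = T ;
  grid_lt : forall i, (i < n)%N -> t i < t i.+1 ;
  grid_mesh : forall i, (i < n)%N -> t i.+1 - t i <= rho }.

(** The grid sorts the points of [l] together with a uniform subdivision; removing duplicates makes
    all steps positive. The final disjunction says that no point of [l] lies inside a cell. *)
Lemma exists_refined_grid (T rho : R) (l : seq R) : 0 < T -> 0 < rho ->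
  (forall x, x \in l -> 0 <= x <= T) ->
  exists n t, is_grid T rho n t /\
    forall x i, x \in l -> (i < n)%N -> x <= t i \/ t i.+1 <= x.
Proof.
move=> T0 rho0 lT.
pose m := (Num.truncn (T / rho)).+1.
have m0 : 0 < m%:R :> R by rewrite ltr0n.
have Tm : T / m%:R <= rho.
  rewrite ler_pdivrMr// mulrC -ler_pdivrMr//; apply: ltW.
  by have /andP[] := truncn_itv (ltW (divr_gt0 T0 rho0)).
pose u := [seq T * (i%:R / m%:R) | i <- iota 0 m.+1].
pose s := sort <=%R (undup (0 :: T :: l ++ u)).
have sS : sorted <%R s by rewrite sort_lt_sorted undup_uniq.
have memS x : (x \in s) = [|| x == 0, x == T, x \in l | x \in u].
  by rewrite mem_sort mem_undup !inE mem_cat.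
have sT x : x \in s -> 0 <= x <= T.
  rewrite memS => /or4P[/eqP->|/eqP->|/lT//|/mapP[i]].
  - by rewrite lexx ltW.
  - by rewrite lexx ltW.
  rewrite mem_iota add0n ltnS => /andP[_ im] ->.
  apply/andP; split; first by rewrite mulr_ge0 ?divr_ge0 ?(ltW T0).
  by rewrite ler_piMr ?(ltW T0)// ler_pdivrMr// mul1r ler_nat.
have s0 : 0 \in s by rewrite memS eqxx.
have sTT : T \in s by rewrite memS eqxx orbT.
have szs : (0 < size s)%N by move: s0; case: (s).
pose n := (size s).-1; pose t i := nth T s i.
have tin i : (i <= n)%N -> (i < size s)%N by rewrite /n -ltnS prednK.
have tS i : (i <= n)%N -> t i \in s by move=> /tin; exact: mem_nth.
have tle i j : (i <= n)%N -> (j <= n)%N -> (i <= j)%N -> t i <= t j.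
  by move=> /tin iS /tin jS ij; rewrite /t lt_sorted_leq_nth.
have tlt i j : (i <= n)%N -> (j <= n)%N -> (i < j)%N -> t i < t j.
  by move=> /tin iS /tin jS ij; rewrite /t lt_sorted_ltn_nth.
have tind x : x \in s -> exists2 i, (i <= n)%N & x = t i.
  move=> xs; exists (index x s); last by rewrite /t nth_index.
  by rewrite /n -ltnS prednK// index_mem.
have sep x i : x \in s -> (i < n)%N -> x <= t i \/ t i.+1 <= x.
  move=> /tind[j jn ->] iltn; have [ji|ij] := leqP j i.
    by left; apply: tle => //; exact: ltnW.
  by right; apply: tle.
have t0 : t 0%N = 0.
  apply/eqP; rewrite eq_le; have /sT/andP[-> _] := tS _ (leq0n n).
  by have [i iltn ->] := tind _ s0; rewrite andbT; apply: tle.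
have tn : t n = T.
  apply/eqP; rewrite eq_le; have /sT/andP[_ ->] := tS _ (leqnn n).
  by have [i iltn {1}->] := tind _ sTT; apply: tle.
exists n, t; split; last first.
  by move=> x i xl; apply: sep; rewrite memS xl !orbT.
split => // i iltn; first by apply: tlt => //; exact: ltnW.
have tiT : t i < T by rewrite -tn; apply: tlt => //; exact: ltnW.
have ex : exists j, t i < T * (j%:R / m%:R) by exists m; rewrite divff ?mulr1 ?gt_eqF.
(* Node [j] is the first uniform node beyond [t i]: it bounds [t i.+1] from above, and its
   predecessor is at most [t i], so the cell is no longer than T / m. *)
case: (ex_minnP ex) => j tij jmin.
have jm : (j <= m)%N by apply: jmin; rewrite divff ?mulr1 ?gt_eqF.
have j0 : (0 < j)%N.
  rewrite lt0n; apply/eqP => j0; move: tij; rewrite j0 mul0r mulr0.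
  by have /sT/andP[/le_gtF ->] := tS i (ltnW iltn).
have tj1 : T * (j.-1%:R / m%:R) <= t i.
  by rewrite leNgt; apply/negP => /jmin; rewrite leqNgt ltn_predL j0.
have : t i.+1 <= T * (j%:R / m%:R).
  have : T * (j%:R / m%:R) \in s.
    rewrite memS; apply/or4P; apply: Or44; apply/mapP; exists j => //.
    by rewrite mem_iota add0n ltnS jm.
  by move=> /sep /(_ iltn)[|//]; rewrite leNgt tij.
move=> tj; rewrite (le_trans _ Tm)//.
have -> : T / m%:R = T * (j%:R / m%:R) - T * (j.-1%:R / m%:R).
  by rewrite -mulrBr -mulrBl -natrB ?leq_pred// -[in (j - _)%N](prednK j0) subSnn mul1r.
by rewrite lerB.
Qed.

(* Clamping [b] outside of [p, q] turns the sum into a telescoping one. *)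
Lemma sum_indic_increments (T rho : R) (n : nat) (t : nat -> R) (p q : R)
    (b : R -> R) :
  is_grid T rho n t -> 0 <= p -> p <= q -> q <= T ->
  (forall i, (i < n)%N -> p <= t i \/ t i.+1 <= p) ->
  (forall i, (i < n)%N -> q <= t i \/ t i.+1 <= q) ->
  \sum_(j < n) \1_`[p, q[ (t j) * (b (t j.+1) - b (t j)) = b q - b p.
Proof.
move=> [t0 tn tlt _] p0 pq qT sepp sepq.
pose G x := b (Num.min (Num.max x p) q).
transitivity (\sum_(j < n) (G (t j.+1) - G (t j))); last first.
  rewrite -(big_mkord xpredT (fun j => G (t j.+1) - G (t j))) telescope_sumr//.
  rewrite t0 tn /G (max_r p0) (min_l pq).
  by rewrite (max_l (le_trans pq qT)) (min_r qT).
apply: eq_bigr => j _; rewrite indicE /G.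
have tj := tlt _ (ltn_ord j).
have [pj|jp] := sepp _ (ltn_ord j); last first.
  rewrite memNset/= ?in_itv/=; last first.
    by apply/negP; rewrite negb_and -ltNge (lt_le_trans tj).
  by rewrite (max_r jp) (max_r (le_trans (ltW tj) jp)) subrr mul0r.
have [qj|jq] := sepq _ (ltn_ord j).
  rewrite memNset/= ?in_itv/=; last first.
    by apply/negP; rewrite negb_and -!leNgt qj orbT.
  rewrite (max_l pj) (max_l (le_trans pj (ltW tj))) (min_r qj).
  by rewrite (min_r (le_trans qj (ltW tj))) subrr mul0r.
rewrite mem_set/= ?in_itv/= ?pj ?(lt_le_trans tj)// mul1r.
rewrite (max_l pj) (max_l (le_trans pj (ltW tj))) (min_l jq).
by rewrite (min_l (le_trans (ltW tj) jq)).
Qed.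

Context {d : measure_display} {Omega : measurableType d}.
Variable F : R -> set (set Omega).
Hypothesis hF : is_filtration F.

Lemma step_time_itv (T : R) (h : step_process F T) i : (i <= step_size h)%N ->
  0 <= step_time h i <= T.
Proof.
have mono j k : (j <= k)%N -> (k <= step_size h)%N -> step_time h j <= step_time h k.
  elim: k => [|k IH]; first by rewrite leqn0 => /eqP ->.
  rewrite leq_eqVlt => /orP[/eqP ->//|jk] kn.
  by rewrite (le_trans (IH jk (ltnW kn)))// step_time_le.
move=> ih; apply/andP; split.
  by rewrite -[leLHS](step_time0 h); exact: mono.
by rewrite -[leRHS](step_timeT h); exact: mono.
Qed.

(** Step times may repeat or be far apart, whereas the estimates need positive steps of small mesh.
    No step time falls inside a refined cell, so the process is constant on cells and its integral
    is unchanged. *)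
Lemma step_process_refinement (T rho : R) (h : step_process F T) :
  0 < T -> 0 < rho ->
  exists n t, [/\ is_grid T rho n t,
    forall i, (i < n)%N -> measurable_wrt (F (t i)) (step_value h (t i)),
    forall (B : R -> Omega -> R) omega,
      \sum_(i < n) step_value h (t i) omega * (B (t i.+1) omega - B (t i) omega) =
      step_integral h B omega &
    forall i r omega, (i < n)%N -> t i <= r < t i.+1 ->
      step_value h r omega = step_value h (t i) omega].
Proof.
move=> T0 rho0.
pose l := [seq step_time h i | i <- iota 0 (step_size h).+1].
have ml i : (i <= step_size h)%N -> step_time h i \in l.
  by move=> ih; apply: map_f; rewrite mem_iota add0n ltnS.
have lT x : x \in l -> 0 <= x <= T.
  by move=> /mapP[i]; rewrite mem_iota add0n ltnS => /andP[_ ih] ->; exact: step_time_itv.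
have [n [t [gt sep]]] := exists_refined_grid T0 rho0 lT.
have [t0 tn tlt _] := gt.
exists n, t; split => //.
- move=> i iltn; have ti := grid_ge0 t0 tlt (ltnW iltn).
  have sG := filtration_sigma_algebra hF ti.
  apply/(measurable_wrtP _ sG); apply: measurable_sum => j.
  (* A term survives only if its step time is at most [t i], and then its coefficient is known at
     [t i]. *)
  rewrite indicE; case: (boolP (_ \in _)) => [|_]; last first.
    rewrite (_ : (fun _ => _) = cst 0); first exact: measurable_cst.
    by apply/funext => omega; rewrite mulr0.
  rewrite inE/= in_itv/= => /andP[hji _].
  apply: measurable_funM => //; apply/(measurable_wrtP _ sG).
  apply: (@measurable_wrtS _ _ _ (F (step_time h j))).
    apply: (filtration_nondecreasing hF) => //.
    by have /andP[] := step_time_itv (ltnW (ltn_ord j)).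
  exact: step_coef_measurable.
- move=> B omega; rewrite /step_value /step_integral.
  under eq_bigr do rewrite mulr_suml.
  rewrite exchange_big/=; apply: eq_bigr => i _.
  under eq_bigr do rewrite -mulrA.
  rewrite -mulr_sumr; congr (_ * _).
  have i1 : step_time h i \in l by apply: ml; exact: ltnW.
  have i2 : step_time h i.+1 \in l by exact: ml.
  apply: (sum_indic_increments (B ^~ omega) gt).
  + by have /andP[] := lT _ i1.
  + exact: step_time_le.
  + by have /andP[] := lT _ i2.
  + by move=> j jn; exact: sep.
  + by move=> j jn; exact: sep.
- move=> i r omega iltn /andP[tir rti]; rewrite /step_value.
  apply: eq_bigr => j _; congr (_ * _); rewrite !indicE; congr (nat_of_bool _)%:R.
  have i1 : step_time h j \in l by apply: ml; exact: ltnW.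
  have i2 : step_time h j.+1 \in l by exact: ml.
  have lei : t i <= t i by [].
  have eqi x : (x <= t i \/ t i.+1 <= x) -> (x <= r) = (x <= t i).
    case=> [h1|h1]; first by rewrite h1 (le_trans h1).
    by rewrite !leNgt (lt_le_trans rti h1) (lt_le_trans (tlt _ iltn) h1).
  have eqi' x : (x <= t i \/ t i.+1 <= x) -> (r < x) = (t i < x).
    by move=> h1; rewrite !ltNge eqi.
  apply/idP/idP; rewrite !inE/= !in_itv/= eqi ?eqi'//; exact: sep.
Qed.

End refinement.

(** * Continuous paths *)

Section paths.
Context {R : realType}.
Implicit Types r q T eps eta K : R.
Variable x : R -> R.
Hypothesis cx : {within `[0, +oo[, continuous x}.

Lemma path_continuousP r eps : 0 <= r -> 0 < eps ->
  exists2 delta, 0 < delta &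
    forall q, 0 <= q -> `|q - r| < delta -> `|x q - x r| < eps.
Proof.
move=> r0 eps0; have /subspace_continuousP/(_ r) := cx.
have Ar : `[0, +oo[%classic r by rewrite /= in_itv/= r0.
move=> /(_ Ar) /cvgrPdist_lt /(_ _ eps0).
rewrite near_withinE => /nbhs_ballP[delta/= delta0 h].
exists delta => // q q0 qr; rewrite distrC; apply: h.
  by rewrite /ball/= distrC.
by rewrite /= in_itv/= q0.
Qed.

Lemma path_bounded T : 0 <= T -> exists K, forall r, 0 <= r <= T -> `|x r| <= K.
Proof.
move=> T0.
have c1 : {within `[0, T], continuous (fun r => `|x r|)}.
  apply: continuous_subspaceW => [r|]; last first.
    move=> r; apply: (@continuous_comp _ _ _ (x : subspace `[0, +oo[ -> R)); first exact: cx.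
    exact: norm_continuous.
  by rewrite /= !in_itv/= => /andP[-> _].
have [c _ hc] := EVT_max T0 c1.
by exists `|x c| => r rT; apply: hc; rewrite in_itv.
Qed.

(** Heine's theorem through the near-covering form of compactness: around each r, half of the local
    modulus [delta] is spent on moving the centre and half on [rho]. *)
Lemma path_uniform_continuity T eta : 0 < eta ->
  exists2 rho, 0 < rho & forall r q, 0 <= r <= T -> 0 <= q <= T ->
    `|q - r| <= rho -> `|x q - x r| <= eta.
Proof.
move=> eta0.
have /compact_near_coveringP cc := @segment_compact R 0 T.
pose Q (rho r : R) := 0 <= r <= T -> forall q, 0 <= q <= T ->
  `|q - r| <= rho -> `|x q - x r| <= eta.
have := cc R (nbhs 0^'+) Q _.
have eta2 : 0 < eta / 2 by rewrite divr_gt0.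
case.
  move=> r; rewrite /= in_itv/= => /andP[r0 rT].
  have [delta delta0 h] := path_continuousP r0 eta2.
  have d2 : 0 < delta / 2 by rewrite divr_gt0.
  exists (ball r (delta / 2), [set rho | rho < delta / 2]).
    split; first exact: nbhsx_ballx.
    exact: nbhs_right_lt.
  move=> [r' rho]/= [br' hrho] /andP[r'0 r'T] q /andP[q0 qT] qr'.
  rewrite /ball/= in br'.
  have h1 : `|x r' - x r| < eta / 2.
    by apply: h => //; rewrite distrC (lt_trans br')// ltr_pdivrMr// ltr_pMr// ltr1n.
  have h2 : `|x q - x r| < eta / 2.
    apply: h => //; rewrite -(subrKA r') (le_lt_trans (ler_normD _ _))//.
    by rewrite (splitr delta) ltrD// ?(distrC r')// (le_lt_trans qr').
  rewrite -(subrKA (x r)) (le_trans (ler_normD _ _))// (splitr eta) lerD ?ltW//.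
  by rewrite distrC.
move=> /= rho0 rho00 h.
exists (rho0 / 2); first by rewrite divr_gt0.
move=> r q rT qT; apply: (h (rho0 / 2)) => //=.
- rewrite sub0r normrN gtr0_norm ?divr_gt0//.
  by rewrite ltr_pdivrMr// ltr_pMr// ltr1n.
- by rewrite divr_gt0.
Qed.

End paths.

(** * Joint measurability of paths, and events on whole path segments *)

Section path_measurability.
Context {R : realType} {d : measure_display} {Omega : measurableType d}.
Implicit Types (X : R -> Omega -> R) (r : R).

(** Samples the path at the left ends of cells of length 1 / (n+1) covering [0, n+1[, whence (n+1)^2
    cells; [Num.max 0] extends paths to negative times. *)
Let discretized X (n : nat) (z : Omega * measurableTypeR R) : R :=
  \sum_(i < n.+1 * n.+1)
    X (i%:R / n.+1%:R) z.1 *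
    \1_`[i%:R / n.+1%:R, i.+1%:R / n.+1%:R[ (Num.max 0 (z.2 : R)).

Let discretizedE X n (z : Omega * measurableTypeR R) :
  Num.max 0 (z.2 : R) < n.+1%:R ->
  discretized X n z =
  X ((Num.truncn (Num.max 0 (z.2 : R) * n.+1%:R))%:R / n.+1%:R) z.1.
Proof.
set r := Num.max _ _ => rn.
have r0 : 0 <= r by rewrite /r le_max lexx.
have n0 : 0 < n.+1%:R :> R by [].
have rn0 : 0 <= r * n.+1%:R by rewrite mulr_ge0.
have mem (i : nat) : (r \in `[i%:R / n.+1%:R, i.+1%:R / n.+1%:R[%classic) =
    (Num.truncn (r * n.+1%:R) == i).
  rewrite truncn_eq//; apply/idP/idP; rewrite inE/= in_itv/=;
    by rewrite ler_pdivrMr// ltr_pdivlMr.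
have i0n : (Num.truncn (r * n.+1%:R) < n.+1 * n.+1)%N.
  rewrite -(ltr_nat R); have /andP[h _] := truncn_itv rn0.
  by rewrite (le_lt_trans h)// natrM ltr_pM2r.
rewrite /discretized (bigD1 (Ordinal i0n))//= big1 ?addr0; last first.
  move=> i; rewrite -val_eqE/= eq_sym => /negbTE ne.
  by rewrite indicE -/r mem ne mulr0.
by rewrite indicE -/r mem eqxx mulr1.
Qed.

(** Continuity makes the process a pointwise limit of its discretizations. Joint measurability
    serves both the time integral in the Ito error and the value of [S] at a random time. *)
Lemma measurable_path X : (forall r, 0 <= r -> measurable_fun setT (X r)) ->
  continuous_paths X ->
  measurable_fun setT
    (fun z : Omega * measurableTypeR R => X (Num.max 0 (z.2 : R)) z.1).
Proof.
move=> mX cX; apply: (measurable_fun_cvg (h := discretized X)).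
  move=> n; apply: measurable_sum => i; apply: measurable_funM.
    apply: (measurableT_comp (mX _ _)); last exact: measurable_fst.
    by rewrite divr_ge0.
  have mi : measurable_fun setT
      (\1_`[i%:R / n.+1%:R, i.+1%:R / n.+1%:R[ : R -> R) by exact: measurable_indic.
  apply: (measurableT_comp mi).
  by apply: measurable_maxr => //; exact: measurable_snd.
move=> z _; set r := Num.max _ _.
have r0 : 0 <= r by rewrite /r le_max lexx.
apply/cvgrPdist_lt => eps eps0.
have [delta delta0 h] := path_continuousP (cX z.1) r0 eps0.
near=> n.
have n0 : 0 < n.+1%:R :> R by [].
have rn : r < n.+1%:R.
  near: n; exists (Num.truncn r).+1 => // n/= hn.
  have /andP[_ h1] := truncn_itv r0; rewrite (lt_le_trans h1)// ler_nat.
  exact: leq_trans hn _.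
rewrite discretizedE// -/r distrC; apply: h; first by rewrite divr_ge0.
have rn0 : 0 <= r * n.+1%:R by rewrite mulr_ge0.
have /andP[h1 h2] := truncn_itv rn0.
rewrite -(ltr_pM2r n0) -[X in `|_| * X]gtr0_norm// -normrM mulrBl divfK ?gt_eqF//.
rewrite distrC ger0_norm ?subr_ge0//.
apply: (@lt_le_trans _ _ 1); first by rewrite ltrBlDr addrC natr1.
rewrite -ler_pdivrMl// mulr1; near: n.
exists (Num.truncn delta^-1).+1 => // n/= hn.
have di0 : 0 <= delta^-1 by rewrite invr_ge0 ltW.
have /andP[_ h3] := truncn_itv di0; rewrite (le_trans (ltW h3))// ler_nat.
exact: leq_trans hn _.
Unshelve. all: by end_near. Qed.

(* Rescaling the rationals of [0, 1] by [t] makes the endpoint [t] one of the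
   countably many test times. *)
Lemma forall_path_countable X (C : set R) (t : R) omega : continuous_paths X ->
  closed C -> 0 <= t ->
  (forall r : R, 0 <= r <= t -> C (X r omega)) <->
  (forall q : rat, 0 <= q <= 1 -> C (X (ratr q * t) omega)).
Proof.
move=> cX cC t0; split=> [h q /andP[q0 q1]|h r /andP[r0 rt]].
  apply: h; rewrite mulr_ge0 ?ler0q//=.
  by rewrite ler_piMl//; move: q1; rewrite -(@ler_rat R) rmorph1.
have : closure C (X r omega); last by move=> /cC.
move=> V /nbhs_ballP[eps/= eps0 heps].
have [delta delta0 hd] := path_continuousP (cX omega) r0 eps0.
have [t00|tn0] := eqVneq t 0.
  have r00 : r = 0 by apply/eqP; rewrite eq_le r0 -t00 rt.
  exists (X r omega); split.
    have := h 0; rewrite lexx ler01 => /(_ isT).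
    by rewrite rmorph0 mul0r r00.
  by apply: heps; exact: ballxx.
have {tn0}t0 : 0 < t by rewrite lt_def tn0.
have [r1|r1] := ltP r t; last first.
  have rt' : r = t by apply/eqP; rewrite eq_le rt.
  exists (X r omega); split.
    have := h 1; rewrite lexx ler01 => /(_ isT).
    by rewrite rmorph1 mul1r rt'.
  by apply: heps; exact: ballxx.
have lt1 : r / t < Num.min 1 ((r + delta) / t).
  rewrite lt_min ltr_pdivrMr// mul1r r1/= ltr_pM2r ?invr_gt0//.
  by rewrite ltrDl.
have [q] := rat_in_itvoo lt1.
rewrite in_itv/= lt_min => /and3P[q1 q2 q3].
rewrite ltr_pdivrMr// in q1; rewrite ltr_pdivlMr// in q3.
have q0 : 0 <= q.
  rewrite -(@ler0q R) -(ler_pM2r t0) mul0r; exact: le_trans r0 (ltW q1).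
exists (X (ratr q * t) omega); split.
  apply: h; rewrite q0/=.
  by rewrite -(@ler_rat R) rmorph1 ltW.
apply: heps; rewrite /ball/= distrC; apply: hd.
  exact: le_trans r0 (ltW q1).
rewrite gtr0_norm ?subr_gt0//; lra.
Qed.

Variable F : R -> set (set Omega).
Hypothesis hF : is_filtration F.

Lemma forall_path_adapted X (C : set R) (t : R) : adapted F X -> continuous_paths X ->
  closed C -> 0 <= t -> F t [set omega | forall r : R, 0 <= r <= t -> C (X r omega)].
Proof.
move=> aX cX cC t0.
have sG := filtration_sigma_algebra hF t0.
pose E (q : rat) := if 0 <= q <= 1 then (X (ratr q * t)) @^-1` C else setT.
have FE q : measurable (E q : set (g_sigma_algebraType (F t))).
  rewrite /E; case: ifPn => [/andP[q0 q1]|_]; last exact: measurableT.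
  have qt0 : 0 <= ratr q * t by rewrite mulr_ge0 ?ler0q.
  apply: sub_sigma_algebra.
  apply: (@measurable_wrtS _ _ _ (F (ratr q * t)) _ (X (ratr q * t))).
  - apply: (filtration_nondecreasing hF) => //.
    by rewrite ler_piMl//; move: q1; rewrite -(@ler_rat R) rmorph1.
  - exact: aX.
  - exact: closed_measurable.
pose E' (n : nat) := if unpickle n is Some q then E q else setT.
have mE' : measurable (\bigcap_n (E' n : set (g_sigma_algebraType (F t)))).
  apply: bigcap_measurableType => n _; rewrite /E'.
  by case: (unpickle n) => [q|]; [exact: FE|exact: measurableT].
rewrite (_ : [set _ | _] = \bigcap_n E' n).
  by move: mE'; rewrite /measurable/= sigma_algebra_id.
apply/seteqP; split => omega /=.
  move=> /(forall_path_countable omega cX cC t0) h n _; rewrite /E' /E.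
  by case: unpickle => // q; case: ifPn => // q01; exact: h.
move=> h; apply/(forall_path_countable omega cX cC t0) => q q01.
by have := h (pickle q) I; rewrite /E' pickleK /E q01.
Qed.

End path_measurability.

(** * The Ito integral as a limit of Riemann sums *)

Section riemann_sums.
Context {R : realType}.

Lemma cvge0_eventually_lt (u : nat -> \bar R) (eta : R) :
  u @ \oo --> 0%E -> 0 < eta ->
  exists N, forall n, (N <= n)%N -> (u n < eta%:E)%E.
Proof.
move=> u0 eta0.
have [N _ hN] : \forall n \near \oo, (u n < eta%:E)%E.
  apply: (u0 [set y | (y < eta%:E)%E]); apply: open_nbhs_nbhs; split.
    exact: open_ereal_lt_ereal.
  by rewrite /= lte_fin.
by exists N => n Nn; exact: hN.
Qed.

Lemma grid_sum_le_integral (T rho : R) n (t : nat -> R) (c : nat -> R)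
    (g : R -> R) : is_grid T rho n t ->
  measurable_fun setT g -> (forall r, 0 <= g r) ->
  (forall i r, (i < n)%N -> t i <= r < t i.+1 -> c i <= g r) ->
  ((\sum_(i < n) c i * (t i.+1 - t i))%:E <=
   \int[lebesgue_measure]_(r in `[0%R, T]) (g r)%:E)%E.
Proof.
move=> [t0 tn tlt _] mg g0 cg.
have mgS D : measurable_fun D (EFin \o g).
  by apply/measurable_EFinP; exact: measurable_funTS.
suff h j : (j <= n)%N -> ((\sum_(i < j) c i * (t i.+1 - t i))%:E <=
    \int[lebesgue_measure]_(r in `[0%R, t j[) (g r)%:E)%E.
  apply: (le_trans (h n (leqnn n))); rewrite tn.
  apply: ge0_subset_integral => //.
  - exact: mgS.
  - by move=> r _; rewrite lee_fin.
  - by apply: subset_itvl; rewrite bnd_simp.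
elim: j => [|j IH] jn.
  by rewrite big_ord0; apply: integral_ge0 => r _; rewrite lee_fin.
have tj0 := grid_ge0 t0 tlt (ltnW jn).
rewrite big_ord_recr/= EFinD.
have -> : (`[0, t j.+1[ = `[0, t j[ `|` `[t j, t j.+1[)%classic.
  by rewrite -itv_bndbnd_setU// bnd_simp// ltW// tlt.
rewrite ge0_integral_setU//=; last 3 first.
- exact: mgS.
- by move=> r _; rewrite lee_fin.
- apply/disj_setPS => r [/=]; rewrite !in_itv/= => /andP[_ h1] /andP[h2 _].
  by rewrite ltNge h2 in h1.
apply: leeD; first exact: IH (ltnW jn).
(* [c j] may be negative while the comparison is between nonnegative integrands; clamping it at 0
   keeps it below [g]. *)
apply: (@le_trans _ _ (\int[lebesgue_measure]_(r in `[t j, t j.+1[) (Num.max 0 (c j))%:E)%E).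
  rewrite integral_cst//= lebesgue_measure_itv/= lte_fin tlt// -EFinB -EFinM lee_fin.
  by rewrite ler_pM2r ?subr_gt0 ?tlt// le_max lexx orbT.
apply: ge0_le_integral => //.
- by move=> r _; rewrite lee_fin le_max lexx.
- exact: mgS.
- by move=> r; rewrite /= in_itv/= => rj; rewrite lee_fin ge_max g0 (cg j).
Qed.

Context {d : measure_display} {Omega : measurableType d}.
Variable P : probability Omega R.

(** The tail unions decrease to the empty set, so continuity from above applies. *)
Lemma prob_eventually_outside (C : nat -> set Omega) (eta : R) :
  (forall n, measurable (C n)) ->
  (forall omega, exists N, forall n, (N <= n)%N -> ~ C n omega) -> 0 < eta ->
  exists N, forall n, (N <= n)%N -> (P (C n) < eta%:E)%E.
Proof.
move=> mC hC eta0.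
pose U m := \bigcup_(i >= m) C i.
have mU m : measurable (U m) by apply: bigcup_measurable.
have cU : P \o U @ \oo --> 0%E.
  have U0 : \bigcap_m U m = set0.
    apply/seteqP; split => // omega hU.
    by have [N hN] := hC omega; have [i /= /hN] := hU N I.
  rewrite -(@measure0 _ _ _ P) -U0; apply: nonincreasing_cvg_mu => //.
  - by rewrite (le_lt_trans (probability_le1 _ (mU 0)))// ltry.
  - by rewrite U0.
  - by move=> m k mk; apply/subsetPset => omega [i /= ki Ci]; exists i => //=; exact: leq_trans ki.
have [N hN] := cvge0_eventually_lt cU eta0.
exists N => n /hN; apply: le_lt_trans; apply: le_measure; rewrite ?inE//.
by move=> omega Co; exists n => /=.
Qed.

Variables (F : R -> set (set Omega)).
Hypothesis hF : is_filtration F.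

Lemma measurable_step_value (T : R) (h : step_process F T) :
  measurable_fun setT
    (fun z : Omega * measurableTypeR R => step_value h z.2 z.1).
Proof.
apply: measurable_sum => i; apply: measurable_funM.
  have mc : measurable_fun setT (step_coef h i).
    apply: measurable_wrtT (step_coef_measurable (ltn_ord i)).
    apply: (filtration_measurable hF).
    by have /andP[] := step_time_itv (h := h) (ltnW (ltn_ord i)).
  by apply: (measurableT_comp mc); exact: measurable_fst.
have mi : measurable_fun setT
  (\1_`[step_time h i, step_time h i.+1[ : R -> R) by exact: measurable_indic.
by apply: (measurableT_comp mi); exact: measurable_snd.
Qed.

Variable S : R -> Omega -> R.
Hypotheses (aS : adapted F S) (cS : continuous_paths S).

Let sq_error (a T : R) (h : step_process F T) (z : Omega * measurableTypeR R) : R :=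
  (step_value h z.2 z.1 - a * S (Num.max 0 (z.2 : R)) z.1) ^+ 2.

Let measurable_sq_error a T (h : step_process F T) :
  measurable_fun setT (sq_error a h).
Proof.
apply: measurable_funX; apply: measurable_funB; first exact: measurable_step_value.
apply: measurable_funM => //; apply: measurable_path => // r r0.
exact: (adapted_measurable hF).
Qed.

Lemma measurable_ito_error (a T : R) (h : step_process F T) :
  measurable_fun setT (fun omega => \int[lebesgue_measure]_(r in `[0%R, T])
    ((step_value h r omega - a * S r omega) ^+ 2)%:E)%E.
Proof.
pose f (z : Omega * measurableTypeR R) : \bar R :=
  (sq_error a h z * \1_`[0, T] (z.2 : R))%:E.
have mf : measurable_fun setT f.
  apply/measurable_EFinP; apply: measurable_funM; first exact: measurable_sq_error.
  have mi : measurable_fun setT (\1_`[0, T] : R -> R) by exact: measurable_indic.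
  by apply: (measurableT_comp mi); exact: measurable_snd.
have f0 z : (0 <= f z)%E by rewrite lee_fin mulr_ge0 ?sqr_ge0.
have := measurable_fun_fubini_tonelli_F (m2 := lebesgue_measure) f mf f0.
congr (measurable_fun _ _); apply/funext => omega; rewrite [RHS]integral_mkcond.
apply: eq_integral => r _; rewrite patchE /f indicE/=.
case: ifPn => h0; last by rewrite mulr0.
rewrite mulr1 /sq_error/= max_r//.
by move: h0; rewrite inE/= in_itv/= => /andP[].
Qed.

Variables (B : R -> Omega -> R) (a : R).
Hypotheses (hB : is_brownian_motion P F B).

(** On a refined grid, [k] is the gap between the step process and a S at the grid points. Its
    quadratic sum is at most twice the L2 error of the step process plus an oscillation term of [S],
    both small in probability; Lenglart then compares the two elementary integrals. *)
Lemma ito_integral_riemann (T rho eps eta : R) (X : Omega -> R) :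
  is_ito_integral P F B (fun r omega => a * S r omega) T X ->
  measurable_fun setT X ->
  0 < T -> 0 < rho -> 0 < eps -> 0 < eta ->
  exists n t, is_grid T rho n t /\
    (P [set omega | (eps <= `|\sum_(i < n)
      a * S (t i) omega * (B (t i.+1) omega - B (t i) omega) - X omega|)%R] <=
     eta%:E)%E.
Proof.
move=> [h [hL2 hint]] mX T0 rho0 eps0 eta0.
have eps2 : 0 < eps / 2 by rewrite divr_gt0.
have eta4 : 0 < eta / 4 by rewrite divr_gt0.
(* [kap * delta = eta / 4] is the second term of Lenglart's bound; [theta] makes the oscillation
   term 2 a^2 theta T at most delta / 2, and an L2 error below delta / 4 contributes less than the
   other half. *)
pose kap : R := (eps / 2) ^- 2 * (2 * expR 8).
have kap0 : 0 < kap by rewrite mulr_gt0 ?invr_gt0 ?exprn_gt0 ?mulr_gt0 ?expR_gt0.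
pose delta := eta / 4 / kap.
have delta0 : 0 < delta by rewrite divr_gt0.
have delta4 : 0 < delta / 4 by rewrite divr_gt0.
pose theta := delta / 4 / (T * (1 + a ^+ 2)).
have a20 : 0 < 1 + a ^+ 2 by rewrite ltr_wpDr ?sqr_ge0.
have theta0 : 0 < theta by apply: divr_gt0 => //; exact: mulr_gt0.
pose rhom m := Num.min rho (m.+1%:R^-1).
have rhom0 m : 0 < rhom m by rewrite lt_min rho0 invr_gt0/=.
pose gr m := cid (step_process_refinement hF (h m) T0 (rhom0 m)).
pose n m := projT1 (gr m).
pose t m := projT1 (cid (projT2 (gr m))).
have gP m := projT2 (cid (projT2 (gr m))).
rewrite -/(gr _) in gP.
pose k m i omega := step_value (h m) (t m i) omega - a * S (t m i) omega.
have grid m : is_grid T (rhom m) (n m) (t m) by have [] := gP m.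
have tge0 m i : (i <= n m)%N -> 0 <= t m i.
  by have [t0 _ tlt _] := grid m; exact: grid_ge0.
have hk m i : (i < n m)%N -> measurable_wrt (F (t m i)) (k m i).
  move=> inm; have ti := tge0 m i (ltnW inm).
  have sG := filtration_sigma_algebra hF ti.
  apply/(measurable_wrtP _ sG); apply: measurable_funB.
    by apply/(measurable_wrtP _ sG); have [_ + _ _] := gP m; exact.
  by apply: measurable_funM => //; apply/(measurable_wrtP _ sG); exact: aS.
have mk m i : (i < n m)%N -> measurable_fun setT (k m i).
  move=> inm; apply: (measurable_wrtT _ (hk m i inm)).
  exact: (filtration_measurable hF (tge0 m i (ltnW inm))).
pose I m omega := (\int[lebesgue_measure]_(r in `[0%R, T])
    ((step_value (h m) r omega - a * S r omega) ^+ 2)%:E)%E.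
have mI m : measurable_fun setT (I m) by exact: measurable_ito_error.
have I0 m omega : (0 <= I m omega)%E.
  by apply: integral_ge0 => r _; rewrite lee_fin sqr_ge0.
pose Q m omega := \sum_(i < n m) k m i omega ^+ 2 * (t m i.+1 - t m i).
have mQ m : measurable_fun setT (Q m).
  apply: measurable_sum => i; apply: measurable_funM => //.
  by apply: measurable_funX; exact: mk.
pose C m := [set omega | (2%:E * I m omega + (delta / 2)%:E < (Q m omega)%:E)%E].
have mC m : measurable (C m).
  rewrite -[C m]setTI; apply: measurable_lte => //.
  - apply: emeasurable_funD => //; exact: emeasurable_funM.
  - by apply/measurable_EFinP.
(* The modulus of continuity depends on omega, so [C m] is avoided only eventually, and at a rate
   depending on the path. *)
have hC omega : exists N, forall m, (N <= m)%N -> ~ C m omega.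
  have st0 : 0 < Num.sqrt theta by rewrite sqrtr_gt0.
  have [r0 r00 hr] := path_uniform_continuity (@cS omega) T st0.
  exists (Num.truncn r0^-1).+1 => m hm; apply/negP; rewrite -leNgt.
  have mesh i : (i < n m)%N -> t m i.+1 - t m i <= r0.
    have [_ _ _ hmesh] := grid m; move=> /hmesh; move/le_trans; apply.
    rewrite /rhom ge_min; apply/orP; right.
    rewrite invf_ple ?posrE// ltW//.
    have : 0 <= r0^-1 by rewrite invr_ge0 ltW.
    move=> /truncn_itv/andP[_ h1]; rewrite (lt_le_trans h1)// ler_nat.
    exact: leq_trans hm _.
  have at0 : 0 <= 2 * (a ^+ 2 * theta).
    by apply: mulr_ge0 => //; rewrite mulr_ge0 ?sqr_ge0 ?(ltW theta0).
  pose g (r : R) := 2 * sq_error a (h m) (omega, r) + 2 * (a ^+ 2 * theta).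
  have mg : measurable_fun setT g.
    apply: measurable_funD => //; apply: measurable_funM => //.
    apply: (measurableT_comp (measurable_sq_error a (h m))).
    exact: measurable_fun_pair.
  have g0 r : 0 <= g r.
    by apply: addr_ge0 => //; rewrite mulr_ge0 ?sqr_ge0.
  apply: (le_trans (@grid_sum_le_integral T _ _ _ (fun i => k m i omega ^+ 2) g (grid m) mg g0 _)).
    move=> i r inm rti; have [_ _ _ /(_ i r omega inm rti) hv] := gP m.
    have [gt0 gtn gtlt _] := grid m.
    have ti := tge0 m i (ltnW inm); have tSi := tge0 m i.+1 inm.
    have tiT : t m i.+1 <= T by rewrite -gtn; apply: (grid_le gtlt).
    have /andP[tir rti'] := rti.
    have r0' : 0 <= r by exact: le_trans tir.
    have osc : (S (t m i) omega - S r omega) ^+ 2 <= theta.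
      rewrite -[leRHS]sqr_sqrtr ?(ltW theta0)// -real_normK ?num_real//.
      rewrite lerXn2r ?nnegrE ?(ltW st0)//; apply: hr.
      - by rewrite r0'/= (le_trans (ltW rti')).
      - by rewrite ti/= (le_trans (le_trans tir (ltW rti'))).
      - rewrite distrC ger0_norm ?subr_ge0//; apply: le_trans (mesh i inm).
        by rewrite lerB// ltW.
    rewrite /g /sq_error/= max_r// /k -hv.
    set y := step_value _ _ _; move: osc.
    set p := S (t m i) omega; set q := S r omega => osc.
    have : a ^+ 2 * (p - q) ^+ 2 <= a ^+ 2 * theta by rewrite ler_wpM2l ?sqr_ge0.
    have : 0 <= (y - a * q + a * (p - q)) ^+ 2 by exact: sqr_ge0.
    by nra.
  rewrite /g; under eq_integral do rewrite EFinD EFinM.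
  rewrite ge0_integralD//=; last 2 first.
  - by move=> r _; rewrite -EFinM lee_fin mulr_ge0 ?sqr_ge0.
  - apply: emeasurable_funM => //; apply/measurable_EFinP/measurable_funTS.
    apply: (measurableT_comp (measurable_sq_error a (h m))).
    exact: measurable_fun_pair.
  rewrite ge0_integralZl_EFin//=; last 2 first.
  - by move=> r _; rewrite lee_fin sqr_ge0.
  - apply/measurable_EFinP/measurable_funTS.
    apply: (measurableT_comp (measurable_sq_error a (h m))).
    exact: measurable_fun_pair.
  apply: leeD.
    rewrite lee_wpmul2l ?lee_fin// le_eqVlt; apply/orP; left; apply/eqP.
    apply: eq_integral => r; rewrite inE/= in_itv/= => /andP[r0' _].
    by rewrite /sq_error/= max_r.
  rewrite integral_cst//= lebesgue_measure_itv/= lte_fin T0 sube0 -EFinM lee_fin.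
  rewrite [leLHS](_ : _ = a ^+ 2 / (1 + a ^+ 2) * (delta / 2)); last first.
    by rewrite /theta; field; rewrite !gt_eqF.
  apply: ler_piMl; first by rewrite divr_ge0 ?(ltW delta0).
  by rewrite ler_pdivrMr// mul1r lerDr.
have [N1 hN1] := prob_eventually_outside mC hC eta4.
have [N2 hN2] := cvge0_eventually_lt (hL2 _ delta4) eta4.
have [N3 hN3] := cvge0_eventually_lt (hint _ eps2) eta4.
pose m := maxn N1 (maxn N2 N3).
have {}hN1 := hN1 m (leq_maxl _ _).
have {}hN2 := hN2 m (leq_trans (leq_maxl _ _) (leq_maxr _ _)).
have {}hN3 := hN3 m (leq_trans (leq_maxr _ _) (leq_maxr _ _)).
exists (n m), (t m); split.
  have [? ? ? hmesh] := grid m; split => // i /hmesh /le_trans; apply.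
  by rewrite ge_min lexx.
have [gt0 gtn gtlt _] := grid m.
have mdB i : (i < n m)%N ->
    measurable_fun setT (fun omega => B (t m i.+1) omega - B (t m i) omega).
  by move=> inm; apply: (measurable_increment hF hB); [exact: tge0 (ltnW inm)|exact/ltW/gtlt].
pose Y omega := \sum_(i < n m) k m i omega * (B (t m i.+1) omega - B (t m i) omega).
have mY : measurable_fun setT Y.
  by apply: measurable_sum => i; apply: measurable_funM; [exact: mk|exact: mdB].
have mint : measurable_fun setT (step_integral (h m) B).
  rewrite (_ : step_integral (h m) B = fun omega =>
    \sum_(i < n m) step_value (h m) (t m i) omega * (B (t m i.+1) omega - B (t m i) omega)).
    apply: measurable_sum => i; apply: measurable_funM; last exact: mdB.
    have [_ + _ _] := gP m => /(_ i (ltn_ord i)) /measurable_wrtT; apply.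
    exact: (filtration_measurable hF (tge0 m i (ltnW (ltn_ord i)))).
  by apply/funext => omega; have [_ _ + _] := gP m => ->.
have mge (Z : Omega -> R) c : measurable_fun setT Z -> measurable [set omega | c <= `|Z omega|].
  move=> mZ; rewrite -[X in measurable X]setTI.
  rewrite (_ : [set omega | _] = (fun omega => `|Z omega|) @^-1` `[c, +oo[%classic).
    by apply: (measurableT_comp (@normr_measurable _ setT) mZ).
  by apply/seteqP; split => z /=; rewrite in_itv/= andbT.
set A := [set omega | _].
pose A1 := [set omega | eps / 2 <= `|Y omega|].
pose A2 := [set omega | eps / 2 <= `|step_integral (h m) B omega - X omega|].
have mA1 : measurable A1 by exact: mge.
have mA2 : measurable A2 by apply: mge; exact: measurable_funB.
have EA omega : \sum_(i < n m) a * S (t m i) omega *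
     (B (t m i.+1) omega - B (t m i) omega) - X omega =
   (step_integral (h m) B omega - X omega) - Y omega.
  have [_ _ <- _] := gP m; rewrite addrAC; congr (_ - _).
  by rewrite -sumrB; apply: eq_bigr => i _; rewrite /k; ring.
have mA : measurable A.
  rewrite /A; under eq_set do rewrite EA.
  by apply: (mge (fun omega => _)); apply: measurable_funB => //; exact: measurable_funB.
have PA1 : (P A1 <= P [set omega | (delta < Q m omega)%R] + (eta / 4)%:E)%E.
  apply: (le_trans (lenglart hF hB gt0 gtlt (hk m) eps2 delta0)).
  by rewrite leeD2l// lee_fin mulrA -/kap /delta mulrC divfK ?gt_eqF.
have mge4 : measurable [set omega | ((delta / 4)%:E <= I m omega)%E].
  by rewrite -[X in measurable X]setTI; apply: measurable_lee.
have PQ : (P [set omega | (delta < Q m omega)%R] <= (eta / 4)%:E + (eta / 4)%:E)%E.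
  apply: (@le_trans _ _ (P (C m `|` [set omega | ((delta / 4)%:E <= I m omega)%E]))).
    apply: le_measure; rewrite ?inE//.
    - rewrite -[X in measurable X]setTI.
      rewrite (_ : [set omega | _] = Q m @^-1` `]delta, +oo[%classic); first exact: mQ.
      by apply/seteqP; split => z /=; rewrite in_itv/= andbT.
    - exact: measurableU.
    - move=> omega /= dQ; have [hI|hI] := leP (delta / 4)%:E (I m omega); [by right|left].
      rewrite /C/=; apply: lt_trans (_ : (delta%:E < _)%E) => //.
      have fI : I m omega \is a fin_num by rewrite ge0_fin_numE// (lt_trans hI)// ltry.
      rewrite -(fineK fI) in hI *; rewrite -EFinM -EFinD lte_fin.
      rewrite lte_fin in hI; lra.
  apply: (le_trans (measureU2 _ (mC m) mge4)).
  by apply: leeD; exact: ltW.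
apply: (@le_trans _ _ (P (A1 `|` A2))).
  apply: le_measure; rewrite ?inE//; first exact: measurableU.
  move=> omega; rewrite /A/= EA => h1.
  have [h2|h2] := leP (eps / 2) `|Y omega|; [by left|right].
  rewrite /A2/=; move: h1; set x := _ - X omega => h1.
  have := ler_normB x (Y omega); lra.
apply: (le_trans (measureU2 _ mA1 mA2)).
(* One quarter each for the oscillation event [C m], the L2 error, Lenglart's second term, and the
   distance from the step integral to [X]. *)
have -> : eta%:E = ((eta / 4)%:E + (eta / 4)%:E + (eta / 4)%:E + (eta / 4)%:E)%E.
  by rewrite -!EFinD; congr EFin; field.
apply: leeD; last exact: ltW.
by apply: (le_trans PA1); rewrite leeD2r.
Qed.

End riemann_sums.

(** * The Gronwall estimate *)

Section gronwall.
Context {R : realType}.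

(** Left Riemann sums of an increasing function stay below its integral on every grid; this is what
    produces the factorial in the Gronwall iteration. *)
Lemma grid_sum_expr_le (T rho : R) n (t : nat -> R) m : is_grid T rho n t ->
  \sum_(i < n) (t i ^+ m * (t i.+1 - t i)) <= T ^+ m.+1 / m.+1%:R.
Proof.
move=> [t0 tn tlt _].
have pw (x y : R) k : 0 <= x -> x <= y ->
    k.+1%:R * (x ^+ k * (y - x)) <= y ^+ k.+1 - x ^+ k.+1.
  move=> x0 xy; elim: k => [|k IH]; first by rewrite !expr0 !expr1 !mul1r.
  have h1 : x * (y ^+ k.+1 - x ^+ k.+1) <= y * (y ^+ k.+1 - x ^+ k.+1).
    by rewrite ler_wpM2r// subr_ge0 lerXn2r// nnegrE// (le_trans x0).
  have h2 := ler_wpM2l x0 IH.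
  rewrite -natr1 (exprS y k.+1) (exprS x k.+1).
  have h3 : x * (k.+1%:R * (x ^+ k * (y - x))) = k.+1%:R * (x ^+ k.+1 * (y - x)).
    by rewrite exprS; ring.
  by move: h1 h2; rewrite h3; nra.
rewrite ler_pdivlMr// mulrC mulr_sumr.
apply: (@le_trans _ _ (\sum_(i < n) (t i.+1 ^+ m.+1 - t i ^+ m.+1))).
  apply: ler_sum => i _; apply: pw; last exact/ltW/tlt.
  exact: (grid_ge0 t0 tlt (ltnW (ltn_ord i))).
rewrite -(big_mkord xpredT (fun i => t i.+1 ^+ m.+1 - t i ^+ m.+1)).
by rewrite (telescope_sumr (fun i => t i ^+ m.+1))// t0 tn expr0n subr0.
Qed.

Lemma grid_sum_mesh_le (T rho : R) n (t : nat -> R) : is_grid T rho n t ->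
  \sum_(i < n) (t i.+1 - t i) ^+ 2 <= rho * T.
Proof.
move=> [t0 tn tlt hmesh].
apply: (@le_trans _ _ (\sum_(i < n) rho * (t i.+1 - t i))).
  apply: ler_sum => i _; rewrite expr2 ler_wpM2r ?hmesh// subr_ge0.
  exact/ltW/tlt.
rewrite -mulr_sumr -(big_mkord xpredT (fun i => t i.+1 - t i)).
by rewrite (telescope_sumr t)// t0 tn subr0.
Qed.

Context {d : measure_display} {Omega : measurableType d}.
Variable P : probability Omega R.
Variables (F : R -> set (set Omega)) (B : R -> Omega -> R).
Hypotheses (hF : is_filtration F) (hB : is_brownian_motion P F B).
Variable a : R.

Definition exp_brownian (t : R) (omega : Omega) : R :=
  expR (a * B t omega - a ^+ 2 * t / 2).

Lemma exp_brownian_adapted : adapted F exp_brownian.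
Proof.
move=> t t0; have sG := filtration_sigma_algebra hF t0.
apply/(measurable_wrtP _ sG); apply: measurableT_comp => //.
apply: measurable_funB => //; apply: measurable_funM => //.
by apply/(measurable_wrtP _ sG); exact: brownian_adapted hB _ t0.
Qed.

Lemma exp_brownian_continuous : continuous_paths exp_brownian.
Proof.
move=> omega r; apply: continuous_comp; last exact: continuous_expR.
apply: cvgB.
  by apply: cvgM; [exact: cvg_cst|exact: (brownian_continuous hB)].
apply: cvgM; last exact: cvg_cst.
apply: cvgM; first exact: cvg_cst.
have cid : {within `[0, +oo[, continuous (@id R)}.
  by apply: continuous_subspaceT => x; exact: cvg_id.
exact: cid.
Qed.

(** Discrete form of dE = a E dB, exact up to the defect. *)
Lemma exp_brownian_increment r t omega :
  exp_brownian t omega - exp_brownian r omega =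
  exp_brownian r omega * (a * (B t omega - B r omega) +
    expR_defect a (t - r) (B t omega - B r omega)).
Proof.
rewrite /expR_defect [X in _ = _ * X](_ : _ = expR (a * (B t omega - B r omega) -
  a ^+ 2 * (t - r) / 2) - 1); last by ring.
rewrite mulrBr mulr1 /exp_brownian -expRD; congr (expR _ - _); ring.
Qed.

Variables (s : R) (S : R -> Omega -> R).
Hypothesis hS : solves_linear_sde P F B a s S.

(** Plays the part of a localizing stopping time. E is positive, so an upper bound controls it. *)
Definition bounded_paths (K t : R) : set Omega :=
  [set omega | forall r : R, 0 <= r <= t -> `|S r omega| <= K] `&`
  [set omega | forall r : R, 0 <= r <= t -> exp_brownian r omega <= K].

Lemma bounded_paths_adapted K t : 0 <= t -> F t (bounded_paths K t).
Proof.
move=> t0; have sG := filtration_sigma_algebra hF t0.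
have cl1 : closed [set x : R | `|x| <= K].
  rewrite (_ : [set x | _] = (fun x : R => `|x|) @^-1` [set x | x <= K])//.
  by apply: closed_comp => [x _|]; [exact: norm_continuous|exact: closed_le].
have cl2 : closed [set x : R | x <= K] by exact: closed_le.
have h1 := forall_path_adapted hF (sde_adapted hS) (sde_continuous hS) cl1 t0.
have h2 := forall_path_adapted hF exp_brownian_adapted exp_brownian_continuous cl2 t0.
have : measurable (bounded_paths K t : set (g_sigma_algebraType (F t))).
  by apply: measurableI; exact: sub_sigma_algebra.
by rewrite /measurable/= sigma_algebra_id.
Qed.

Lemma bounded_pathsS K r t : r <= t -> bounded_paths K t `<=` bounded_paths K r.
Proof.
by move=> rt omega [h1 h2]; split => q /andP[q0 qr];
  [apply: h1|apply: h2]; rewrite q0 (le_trans qr).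
Qed.

(** Killed rather than frozen: it becomes 0 once a path has exceeded [K], hence is bounded by (1 +
    |s|) K. *)
Definition stopped_diff (K t : R) (omega : Omega) : R :=
  (S t omega - s * exp_brownian t omega) * \1_(bounded_paths K t) omega.

Lemma stopped_diff_adapted K t : 0 <= t ->
  measurable_wrt (F t) (stopped_diff K t).
Proof.
move=> t0; have sG := filtration_sigma_algebra hF t0.
apply/(measurable_wrtP _ sG); apply: measurable_funM.
  apply: measurable_funB; last apply: measurable_funM => //.
    by apply/(measurable_wrtP _ sG); exact: (sde_adapted hS).
  by apply/(measurable_wrtP _ sG); exact: exp_brownian_adapted.
apply/(measurable_wrtP _ sG); apply: measurable_wrt_indic => //.
exact: bounded_paths_adapted.
Qed.

Lemma stopped_diff_le K t omega : 0 <= t -> 0 <= K ->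
  `|stopped_diff K t omega| <= (1 + `|s|) * K.
Proof.
move=> t0 K0; rewrite /stopped_diff indicE.
case: (boolP (_ \in _)) => [|_]; last first.
  by rewrite mulr0 normr0 mulr_ge0// addr_ge0.
rewrite inE mulr1 => -[/(_ t) h1 /(_ t) h2]; rewrite t0 lexx/= in h1 h2.
rewrite (le_trans (ler_normB _ _))// mulrDl mul1r lerD ?h1// normrM.
by rewrite ler_wpM2l// ger0_norm ?h2// expR_ge0.
Qed.

Definition sq_diff (K t : R) : \bar R :=
  (\int[P]_omega (stopped_diff K t omega ^+ 2)%:E)%E.

(* With probability at least [1 - eta], on bounded paths, the difference at
   time [T] is within [eps] of a martingale sum over the grid, whose second
   moment is the sum of [a^2 sq_diff (t i)] up to the defects. *)
Lemma sq_diff_step (K T rho eps eta : R) (g : R -> R) :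
  0 < K -> 0 < T -> 0 < rho -> rho * a ^+ 2 <= 1 -> 0 < eps -> 0 < eta ->
  (forall t, 0 <= t -> (sq_diff K t <= (g t)%:E)%E) ->
  exists n t, is_grid T rho n t /\
  (sq_diff K T <= (((1 + `|s|) * K) ^+ 2 * eta + 2 * eps ^+ 2 +
    8 * expR 8 * a ^+ 2 * (\sum_(i < n) g (t i) * (t i.+1 - t i)) +
    200 * expR 8 * a ^+ 4 * s ^+ 2 * K ^+ 2 * (rho * T))%:E)%E.
Proof.
move=> K0 T0 rho0 rhoa eps0 eta0 hg.
have mST : measurable_fun setT (fun omega => S T omega - s).
  apply: measurable_funB => //; apply: (adapted_measurable hF) (ltW T0).
  exact: sde_adapted hS.
have [n [t [gr hZ]]] := ito_integral_riemann hF (sde_adapted hS)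
  (sde_continuous hS) hB (sde_integral hS (ltW T0)) mST T0 rho0 eps0 eta0.
exists n, t; split => //.
have [t0 tn tlt hmesh] := gr.
set Z := [set omega | _] in hZ.
pose N0 := [set omega | B 0 omega != 0].
have tge0 i : (i <= n)%N -> 0 <= t i by exact: grid_ge0.
have dt i : (i < n)%N -> 0 < t i.+1 - t i by move=> /tlt; rewrite subr_gt0.
have mF0 (X : Omega -> R) (r : R) : 0 <= r -> measurable_wrt (F r) X -> measurable_fun setT X.
  by move=> r0; apply: measurable_wrtT; exact: (filtration_measurable hF).
pose k i omega := a * stopped_diff K (t i) omega.
pose l i omega := s * exp_brownian (t i) omega * \1_(bounded_paths K (t i)) omega.
have hk i : (i < n)%N -> measurable_wrt (F (t i)) (k i).
  move=> /ltnW /tge0 ti; have sG := filtration_sigma_algebra hF ti.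
  apply/(measurable_wrtP _ sG); apply: measurable_funM => //.
  by apply/(measurable_wrtP _ sG); exact: stopped_diff_adapted.
have hl i : (i < n)%N -> measurable_wrt (F (t i)) (l i).
  move=> /ltnW /tge0 ti; have sG := filtration_sigma_algebra hF ti.
  apply/(measurable_wrtP _ sG); apply: measurable_funM.
    apply: measurable_funM => //; apply/(measurable_wrtP _ sG).
    exact: exp_brownian_adapted.
  apply/(measurable_wrtP _ sG); apply: measurable_wrt_indic => //.
  exact: bounded_paths_adapted.
pose phi i := expR_defect a (t i.+1 - t i).
pose M1 omega := \sum_(i < n) k i omega * (B (t i.+1) omega - B (t i) omega).
pose M2 omega := \sum_(i < n) l i omega * phi i (B (t i.+1) omega - B (t i) omega).
have mM1 : measurable_fun setT M1.
  apply: (mF0 _ _ (tge0 n (leqnn n))).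
  by apply: (measurable_wrt_sum_increments hF hB t0 tlt hk (phi := fun=> id)).
have mM2 : measurable_fun setT M2.
  apply: (mF0 _ _ (tge0 n (leqnn n))).
  apply: (measurable_wrt_sum_increments hF hB t0 tlt hl) => // i _.
  exact: measurable_expR_defect.
have sq i : (i < n)%N -> 0 < Num.sqrt (t i.+1 - t i) by move=> /dt; rewrite sqrtr_gt0.
have sqE i : (i < n)%N -> Num.sqrt (t i.+1 - t i) ^+ 2 = t i.+1 - t i.
  by move=> /dt /ltW h; rewrite sqr_sqrtr.
have EM1 : (\int[P]_omega (M1 omega ^+ 2)%:E <=
    (2 * expR 8 * a ^+ 2 * \sum_(i < n) g (t i) * (t i.+1 - t i))%:E)%E.
  have iso := sum_increments_isometry hF hB t0 tlt hk
    (phi := fun=> id) (v := fun i => 2 * expR 8 * (t i.+1 - t i)).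
  apply: (le_trans (iso _ _ _ n (leqnn n))).
  - by move=> i _; exact: measurable_id.
  - by move=> i /sq; exact: normal_prob_mean0.
  - by move=> i inn; have := normal_prob_variance_le (sq i inn); rewrite sqE.
  rewrite mulr_sumr -sumEFin; apply: lee_sum => i _.
  rewrite /k; under eq_integral do rewrite exprMn EFinM.
  have ti := tge0 i (ltnW (ltn_ord i)).
  rewrite ge0_integralZl_EFin ?sqr_ge0//; last 2 first.
  - by move=> omega _; rewrite lee_fin sqr_ge0.
  - apply/measurable_EFinP/measurable_funX.
    exact: (mF0 _ _ ti (stopped_diff_adapted K ti)).
  rewrite -/(sq_diff K (t i)) muleA -EFinM.
  have := hg _ ti => hgi.
  apply: le_trans (lee_wpmul2l _ hgi) _.
    rewrite lee_fin; apply: mulr_ge0; last exact: sqr_ge0.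
    by rewrite mulr_ge0 ?(ltW (dt _ (ltn_ord i)))// mulr_ge0 ?expR_ge0.
  by rewrite -EFinM lee_fin le_eqVlt; apply/orP; left; apply/eqP; ring.
have EM2 : (\int[P]_omega (M2 omega ^+ 2)%:E <=
    (50 * expR 8 * a ^+ 4 * s ^+ 2 * K ^+ 2 * (rho * T))%:E)%E.
  have iso := sum_increments_isometry hF hB t0 tlt hl
    (phi := phi) (v := fun i => 50 * expR 8 * a ^+ 4 * (t i.+1 - t i) ^+ 2).
  have c0 : 0 <= 50 * expR 8 * a ^+ 4.
    by apply: mulr_ge0; [rewrite mulr_ge0 ?expR_ge0|rewrite exprn_even_ge0].
  have mesh1 i : (i < n)%N -> a ^+ 2 * Num.sqrt (t i.+1 - t i) ^+ 2 <= 1.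
    move=> inn; rewrite sqE// mulrC (le_trans _ rhoa)// ler_wpM2r ?sqr_ge0//.
    exact: hmesh.
  apply: (le_trans (iso _ _ _ n (leqnn n))).
  - by move=> i _; exact: measurable_expR_defect.
  - move=> i inn; rewrite /phi.
    by have := expR_defect_mean0 (sq i inn) (mesh1 i inn); rewrite sqE.
  - move=> i inn; rewrite /phi.
    have := expR_defect_variance_le (sq i inn) (mesh1 i inn).
    by rewrite (_ : 4 = 2 * 2)%N// (exprM (Num.sqrt _)) sqE.
  apply: (@le_trans _ _ (\sum_(i < n)
      (50 * expR 8 * a ^+ 4 * (t i.+1 - t i) ^+ 2 * (s ^+ 2 * K ^+ 2))%:E)%E).
    apply: lee_sum => i _; rewrite [leRHS]EFinM; apply: lee_wpmul2l.
      by rewrite lee_fin; apply: mulr_ge0; [exact: c0|exact: sqr_ge0].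
    rewrite -(integral_probability_cst P (s ^+ 2 * K ^+ 2)).
    apply: ge0_le_integral => //.
    - by move=> omega _; rewrite lee_fin sqr_ge0.
    - apply/measurable_EFinP/measurable_funX.
      exact: (mF0 _ _ (tge0 i (ltnW (ltn_ord i))) (hl _ (ltn_ord i))).
    - move=> omega _; rewrite lee_fin /l indicE.
      case: (boolP (_ \in _)) => [|_]; last by rewrite mulr0 expr0n mulr_ge0 ?sqr_ge0.
      rewrite inE mulr1 => -[_ /(_ (t i))]; rewrite lexx tge0 ?(ltnW (ltn_ord i))//.
      move=> /(_ isT) hE; rewrite exprMn ler_wpM2l ?sqr_ge0// lerXn2r// ?nnegrE ?expR_ge0//.
      exact: ltW.
  rewrite sumEFin lee_fin.
  rewrite (_ : \sum_(i < n) _ = 50 * expR 8 * a ^+ 4 * s ^+ 2 * K ^+ 2 *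
     \sum_(i < n) (t i.+1 - t i) ^+ 2); last first.
    by rewrite mulr_sumr; apply: eq_bigr => i _; ring.
  rewrite ler_wpM2l ?(grid_sum_mesh_le gr)//.
  by apply: mulr_ge0; last exact: sqr_ge0; apply: mulr_ge0 => //; exact: sqr_ge0.
have mB0 : measurable_fun setT (B 0).
  by apply: (adapted_measurable hF) (lexx _); exact: brownian_adapted hB.
have mB00 : measurable [set omega | B 0 omega = 0].
  by rewrite -[X in measurable X]setTI; exact: mB0 (measurable_set1 0).
have mN0 : measurable N0.
  rewrite (_ : N0 = ~` [set omega | B 0 omega = 0]); first exact: measurableC.
  by apply/seteqP; split => omega /= /eqP.
have PN0 : P N0 = 0%E.
  have := probability_setC P mB00; rewrite (brownian_start hB) subee// => <-.
  by congr (P _); apply/seteqP; split => omega /= /eqP.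
have mdB i : (i < n)%N ->
    measurable_fun setT (fun omega => B (t i.+1) omega - B (t i) omega).
  by move=> inn; apply: (measurable_increment hF hB); [exact: tge0 (ltnW inn)|exact/ltW/tlt].
pose W omega := \sum_(i < n) a * S (t i) omega * (B (t i.+1) omega - B (t i) omega)
   - (S T omega - s).
have mW : measurable_fun setT W.
  apply: measurable_funB => //; apply: measurable_sum => i.
  apply: measurable_funM; last exact: mdB.
  apply: measurable_funM => //.
  exact: (mF0 _ _ (tge0 i (ltnW (ltn_ord i))) (sde_adapted hS (tge0 i (ltnW (ltn_ord i))))).
have mZ : measurable Z.
  rewrite -[Z]setTI.
  rewrite (_ : Z = (fun omega => `|W omega|) @^-1` `[eps, +oo[%classic).
    by apply: (measurableT_comp (@normr_measurable _ setT) mW).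
  by apply/seteqP; split => z /=; rewrite in_itv/= andbT.
(* On paths bounded up to [T] every indicator at a grid time is 1, so the killed sums coincide with
   the Riemann sum for [S] and the telescoped increments of E. [B 0 = 0] gives E the initial value
   1. *)
have key omega : bounded_paths K T omega -> B 0 omega = 0 ->
    S T omega - s * exp_brownian T omega = M1 omega - M2 omega - W omega.
  move=> bT B0.
  have bi i : (i < n)%N -> \1_(bounded_paths K (t i)) omega = 1 :> R.
    move=> inn; rewrite indicE mem_set//; apply: bounded_pathsS bT.
    by rewrite -tn; apply: (grid_le tlt) => //; exact: ltnW.
  have ET : exp_brownian T omega - 1 = \sum_(i < n) exp_brownian (t i) omega *
      (a * (B (t i.+1) omega - B (t i) omega) +
       phi i (B (t i.+1) omega - B (t i) omega)).
    under eq_bigr do rewrite -exp_brownian_increment.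
    rewrite -(big_mkord xpredT (fun i =>
      exp_brownian (t i.+1) omega - exp_brownian (t i) omega)).
    rewrite (telescope_sumr (fun i => exp_brownian (t i) omega))// tn t0.
    by rewrite /exp_brownian B0 !mulr0 mul0r subr0 expR0.
  have -> : s * exp_brownian T omega = s * (exp_brownian T omega - 1) + s by ring.
  rewrite ET /W /M1 /M2 mulr_sumr.
  rewrite opprB addrA addrC [RHS]addrC.
  have -> : \sum_(i < n) k i omega * (B (t i.+1) omega - B (t i) omega) =
    \sum_(i < n) a * S (t i) omega * (B (t i.+1) omega - B (t i) omega) -
    \sum_(i < n) s * exp_brownian (t i) omega * (a * (B (t i.+1) omega - B (t i) omega)).
    rewrite -sumrB; apply: eq_bigr => i _.
    by rewrite /k /stopped_diff bi// mulr1; ring.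
  have -> : \sum_(i < n) l i omega * phi i (B (t i.+1) omega - B (t i) omega) =
    \sum_(i < n) s * exp_brownian (t i) omega * phi i (B (t i.+1) omega - B (t i) omega).
    by apply: eq_bigr => i _; rewrite /l bi// mulr1.
  have -> : \sum_(i < n) s * (exp_brownian (t i) omega *
      (a * (B (t i.+1) omega - B (t i) omega) +
       phi i (B (t i.+1) omega - B (t i) omega))) =
    \sum_(i < n) s * exp_brownian (t i) omega * (a * (B (t i.+1) omega - B (t i) omega)) +
    \sum_(i < n) s * exp_brownian (t i) omega * phi i (B (t i.+1) omega - B (t i) omega).
    by rewrite -big_split/=; apply: eq_bigr => i _; ring.
  by ring.
set L := (1 + `|s|) * K.
have mX2 (X : Omega -> R) : measurable_fun setT X ->
    measurable_fun setT (fun omega => (X omega ^+ 2)%:E).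
  by move=> mX; apply/measurable_EFinP; exact: measurable_funX.
have p4 (X : Omega -> R) omega : (0 <= 4%:E * (X omega ^+ 2)%:E)%E.
  by rewrite -EFinM lee_fin mulr_ge0 ?sqr_ge0.
have mZN : measurable (Z `|` N0) by exact: measurableU.
have ZN0 omega : (0 <= (L ^+ 2)%:E * (\1_(Z `|` N0) omega)%:E)%E.
  by rewrite -EFinM lee_fin mulr_ge0 ?sqr_ge0.
have mind : measurable_fun setT (fun omega => ((L ^+ 2)%:E * (\1_(Z `|` N0) omega)%:E)%E).
  by apply: emeasurable_funM => //; apply/measurable_EFinP; exact: measurable_indic.
(* Off [Z] and [N0], (M1 - M2 - W)^2 <= 4 M1^2 + 4 M2^2 + 2 W^2 with |W| < eps; on them the crude
   bound [L ^+ 2] is used. The factor 4 turns 2 e^8 and 50 e^8 into the 8 e^8 and 200 e^8 of the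
   statement. *)
apply: (@le_trans _ _ (\int[P]_omega
  (((L ^+ 2)%:E * (\1_(Z `|` N0) omega)%:E + (2 * eps ^+ 2)%:E) +
   (4%:E * (M1 omega ^+ 2)%:E + 4%:E * (M2 omega ^+ 2)%:E)))%E).
  apply: ge0_le_integral => //.
  - by move=> omega _; rewrite lee_fin sqr_ge0.
  - apply: mX2; exact: (mF0 _ _ (ltW T0) (stopped_diff_adapted K (ltW T0))).
  - by apply: emeasurable_funD; apply: emeasurable_funD => //;
      apply: emeasurable_funM => //; exact: mX2.
  - move=> omega _; rewrite -!EFinM -!EFinD lee_fin.
    have e2 : 0 <= eps ^+ 2 by exact: sqr_ge0.
    have := sqr_ge0 (M1 omega); have := sqr_ge0 (M2 omega).
    have := stopped_diff_le omega (ltW T0) (ltW K0); rewrite -/L => hL.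
    have [hZN|hZN] := pselect ((Z `|` N0) omega).
      rewrite indicE mem_set// mulr1 => h1 h2.
      have : stopped_diff K T omega ^+ 2 <= L ^+ 2.
        by rewrite -real_normK ?num_real// lerXn2r// nnegrE (le_trans _ hL).
      by lra.
    rewrite indicE memNset// mulr0 /stopped_diff indicE.
    case: (boolP (_ \in _)) => [|_]; last by rewrite mulr0 expr0n/=; lra.
    rewrite inE mulr1 => bT h1 h2.
    have B00 : B 0 omega = 0.
      by apply/eqP/negPn/negP => h; apply: hZN; right.
    rewrite (key _ bT B00).
    have hW : `|W omega| < eps.
      by rewrite ltNge; apply/negP => h; apply: hZN; left.
    have : W omega ^+ 2 <= eps ^+ 2.
      by rewrite -real_normK ?num_real// lerXn2r ?nnegrE// ltW.
    have := sqr_ge0 (M1 omega - M2 omega + W omega).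
    have := sqr_ge0 (M1 omega + M2 omega).
    by nra.
rewrite ge0_integralD//; last 4 first.
- by move=> omega _; apply: adde_ge0 => //; rewrite lee_fin mulr_ge0 ?sqr_ge0.
- exact: emeasurable_funD.
- by move=> omega _; exact: adde_ge0.
- by apply: emeasurable_funD; apply: emeasurable_funM => //; exact: mX2.
rewrite ge0_integralD//; last 1 first.
- by move=> omega _; rewrite lee_fin mulr_ge0 ?sqr_ge0.
rewrite ge0_integralD//; last 2 first.
- by apply: emeasurable_funM => //; exact: mX2.
- by apply: emeasurable_funM => //; exact: mX2.
rewrite !ge0_integralZl_EFin ?sqr_ge0//; try exact: mX2; try (by move=> omega _; rewrite lee_fin ?sqr_ge0); last first.
  by apply/measurable_EFinP; exact: measurable_indic.
rewrite integral_probability_cst integral_indic// setIT.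
have PZ : (P (Z `|` N0) <= eta%:E)%E.
  apply: (le_trans (measureU2 _ mZ mN0)); rewrite -[leRHS]adde0.
  by apply: leeD => //; have /eqP := PN0; rewrite eq_le => /andP[].
have c1 : ((L ^+ 2)%:E * P (Z `|` N0) <= (L ^+ 2 * eta)%:E)%E.
  by rewrite [leRHS]EFinM lee_wpmul2l// lee_fin sqr_ge0.
have c40 : (0 <= 4%:E :> \bar R)%E by [].
have c2 := lee_wpmul2l c40 EM1.
have c3 := lee_wpmul2l c40 EM2.
apply: le_trans (leeD (leeD c1 (lexx _)) (leeD c2 c3)) _.
rewrite -!EFinM -!EFinD lee_fin le_eqVlt; apply/orP; left; apply/eqP; ring.
Qed.

End gronwall.

(** * The explicit solution of the linear equation *)

Section explicit_solution.
Context {R : realType} {d : measure_display} {Omega : measurableType d}.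
Variable P : probability Omega R.
Variables (F : R -> set (set Omega)) (B : R -> Omega -> R).
Hypotheses (hF : is_filtration F) (hB : is_brownian_motion P F B).
Variables (a s : R) (S : R -> Omega -> R).
Hypothesis hS : solves_linear_sde P F B a s S.

Lemma probability_neq (X : Omega -> R) (c : R) : measurable_fun setT X ->
  P [set omega | X omega = c] = 1%E ->
  measurable [set omega | X omega != c] /\ P [set omega | X omega != c] = 0%E.
Proof.
move=> mX h; have mE : measurable [set omega | X omega = c].
  by rewrite -[X in measurable X]setTI; exact: mX (measurable_set1 c).
have -> : [set omega | X omega != c] = ~` [set omega | X omega = c].
  by apply/seteqP; split => omega /= /eqP.
split; first exact: measurableC.
by rewrite probability_setC// h subee.
Qed.

Lemma measureU_le (A C : set Omega) (x y : \bar R) :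
  measurable A -> measurable C -> (P A <= x)%E -> (P C <= y)%E ->
  (P (A `|` C) <= x + y)%E.
Proof.
by move=> mA mC hA hC; apply: le_trans (measureU2 _ mA mC) _; exact: leeD.
Qed.

Lemma measurable_S t : 0 <= t -> measurable_fun setT (S t).
Proof. by move=> t0; exact: (adapted_measurable hF (sde_adapted hS)). Qed.

Lemma measurable_exp_brownian t : 0 <= t -> measurable_fun setT (exp_brownian B a t).
Proof.
by move=> t0; apply: (adapted_measurable hF _ t0); exact: exp_brownian_adapted hB _.
Qed.

Lemma measurable_B t : 0 <= t -> measurable_fun setT (B t).
Proof. by move=> t0; exact: (adapted_measurable hF (brownian_adapted hB)). Qed.

Lemma measurable_stopped_diff K t : 0 <= t ->
  measurable_fun setT (stopped_diff B a s S K t).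
Proof.
move=> t0; apply: measurable_wrtT (stopped_diff_adapted hF hB hS K t0).
exact: (filtration_measurable hF).
Qed.

Implicit Types t T : R.

Let L (K : R) := (1 + `|s|) * K.
Let C := 8 * expR 8 * a ^+ 2.

Lemma sq_diff_le K t : 0 < K -> 0 <= t ->
  (sq_diff P B a s S K t <= (L K ^+ 2)%:E)%E.
Proof.
move=> K0 t0; rewrite -(integral_probability_cst P (L K ^+ 2)).
apply: ge0_le_integral => //.
- by move=> omega _; rewrite lee_fin sqr_ge0.
- by apply/measurable_EFinP/measurable_funX; exact: measurable_stopped_diff.
- move=> omega _; have h := stopped_diff_le B a s S omega t0 (ltW K0).
  by rewrite lee_fin -real_normK ?num_real// lerXn2r// nnegrE (le_trans _ h).
Qed.

Lemma sq_diff0 K : 0 < K -> sq_diff P B a s S K 0 = 0%E.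
Proof.
move=> K0; have [mS0 PS0] := probability_neq (measurable_S (lexx 0)) (sde_start hS).
have [mB0 PB0] := probability_neq (measurable_B (lexx 0)) (brownian_start hB).
pose N := [set omega | S 0 omega != s] `|` [set omega | B 0 omega != 0].
have mN : measurable N by exact: measurableU.
have PN : P N = 0%E.
  apply/eqP; rewrite eq_le measure_ge0 andbT -[leRHS]adde0.
  by apply: measureU_le => //; [rewrite PS0|rewrite PB0].
apply/eqP; rewrite eq_le; apply/andP; split; last first.
  by apply: integral_ge0 => omega _; rewrite lee_fin sqr_ge0.
rewrite -(mule0 (L K ^+ 2)%:E) -PN -(setIT N) -integral_indic//.
rewrite -ge0_integralZl_EFin ?sqr_ge0//; last 1 first.
- by apply/measurable_EFinP; exact: measurable_indic.
apply: ge0_le_integral => //.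
- by move=> omega _; rewrite lee_fin sqr_ge0.
- by apply/measurable_EFinP/measurable_funX; exact: measurable_stopped_diff.
- by apply: emeasurable_funM => //; apply/measurable_EFinP; exact: measurable_indic.
move=> omega _; rewrite -EFinM lee_fin indicE.
have [hN|hN] := pselect (N omega).
  rewrite mem_set// mulr1; have h := stopped_diff_le B a s S omega (lexx 0) (ltW K0).
  by rewrite -real_normK ?num_real// lerXn2r// nnegrE (le_trans _ h).
rewrite memNset// mulr0 /stopped_diff.
have -> : S 0 omega = s by apply/eqP/negPn/negP => h; apply: hN; left.
have B0 : B 0 omega = 0 by apply/eqP/negPn/negP => h; apply: hN; right.
by rewrite /exp_brownian B0 !mulr0 mul0r subr0 expR0 mulr1 subrr mul0r expr0n.
Qed.

(** The bound for [m] is fed as [g] into the Gronwall step. The grid depends on the error budget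
    [eta], but the bound on its Riemann sum does not, so [eta] can tend to 0. *)
Lemma sq_diff_factorial K m t : 0 < K -> 0 <= t ->
  (sq_diff P B a s S K t <= (L K ^+ 2 * (C * t) ^+ m / m`!%:R)%:E)%E.
Proof.
move=> K0; elim: m t => [|m IH] T T0.
  by rewrite expr0 mulr1 fact0 invr1 mulr1; exact: sq_diff_le.
have L0 : 0 <= L K ^+ 2 by exact: sqr_ge0.
have C0 : 0 <= C by rewrite /C; apply: mulr_ge0 (sqr_ge0 _); rewrite mulr_ge0 ?expR_ge0.
have [->|Tn0] := eqVneq T 0; first by rewrite sq_diff0// mulr0 expr0n mulr0 mul0r.
have {T0 Tn0}T0 : 0 < T by rewrite lt_def Tn0.
apply/lee_addgt0Pr => eta eta0.
pose c := 200 * expR 8 * a ^+ 4 * s ^+ 2 * K ^+ 2.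
have c0 : 0 <= c.
  apply: mulr_ge0 (sqr_ge0 _); apply: mulr_ge0 (sqr_ge0 _).
  by apply: mulr_ge0; [rewrite mulr_ge0 ?expR_ge0|rewrite exprn_even_ge0].
have a20 : 0 < 1 + a ^+ 2 by rewrite ltr_wpDr ?sqr_ge0.
have cT0 : 0 < c * T + 1 by rewrite ltr_wpDl// mulr_ge0// ltW.
(* [rho], [eps] and [eta1] hold three error terms to eta / 3 each; the first entry of [rho] also
   gives rho a^2 <= 1, and the added 1's keep denominators positive. *)
pose rho := Num.min (1 + a ^+ 2)^-1 (eta / 3 / (c * T + 1)).
have rho0 : 0 < rho by rewrite lt_min invr_gt0 a20/= !divr_gt0.
have rhoa : rho * a ^+ 2 <= 1.
  apply: (@le_trans _ _ ((1 + a ^+ 2)^-1 * (1 + a ^+ 2))); last by rewrite mulVf ?gt_eqF.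
  by apply: ler_pM; rewrite ?sqr_ge0 ?(ltW rho0)// ?ge_min ?lexx// lerDr.
pose eps := Num.min 1 (eta / 6).
have eps0 : 0 < eps by rewrite lt_min ltr01 divr_gt0.
have eps1 : eps <= 1 by rewrite ge_min lexx.
have eps2 : eps <= eta / 6 by rewrite ge_min lexx orbT.
have L1 : 0 < L K ^+ 2 + 1 by rewrite ltr_wpDl.
pose eta1 := eta / 3 / (L K ^+ 2 + 1).
have eta10 : 0 < eta1 by rewrite !divr_gt0.
have [n [t [gr h]]] := sq_diff_step hF hB hS K0 T0 rho0 rhoa eps0 eta10 IH.
apply: (le_trans h); rewrite -EFinD lee_fin -/(L K) -/c -/C.
have e1 : L K ^+ 2 * eta1 <= eta / 3.
  rewrite /eta1 mulrCA; apply: ler_piMr; first by rewrite divr_ge0 ?(ltW eta0).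
  by rewrite ler_pdivrMr// mul1r lerDl.
have e2 : 2 * eps ^+ 2 <= eta / 3.
  have : eps ^+ 2 <= eps by rewrite expr2 ler_piMl ?(ltW eps0).
  by lra.
have e3 : c * (rho * T) <= eta / 3.
  have : rho * (c * T + 1) <= eta / 3.
    by rewrite -ler_pdivlMr// ge_min lexx orbT.
  by have := ltW rho0; lra.
have e4 : C * (\sum_(i < n) L K ^+ 2 * (C * t i) ^+ m / m`!%:R * (t i.+1 - t i)) <=
   L K ^+ 2 * (C * T) ^+ m.+1 / m.+1`!%:R.
  have -> : \sum_(i < n) L K ^+ 2 * (C * t i) ^+ m / m`!%:R * (t i.+1 - t i) =
    L K ^+ 2 * C ^+ m / m`!%:R * \sum_(i < n) (t i ^+ m * (t i.+1 - t i)).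
    by rewrite mulr_sumr; apply: eq_bigr => i _; rewrite (exprMn m C); ring.
  have mf0 : m`!%:R != 0 :> R by rewrite pnatr_eq0 -lt0n fact_gt0.
  have -> : L K ^+ 2 * (C * T) ^+ m.+1 / m.+1`!%:R =
     C * (L K ^+ 2 * C ^+ m / m`!%:R * (T ^+ m.+1 / m.+1%:R)).
    have m10 : m.+1%:R != 0 :> R by rewrite pnatr_eq0.
    rewrite factS natrM (exprMn m.+1 C) (exprS C).
    by move: (m.+1%:R) m10 => q q0; field; rewrite ?mf0 ?q0.
  apply: ler_wpM2l => //; apply: ler_wpM2l; last exact: grid_sum_expr_le gr.
  by rewrite divr_ge0// mulr_ge0// exprn_ge0.
by lra.
Qed.

Lemma sq_diff_eq0 K t : 0 < K -> 0 <= t -> sq_diff P B a s S K t = 0%E.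
Proof.
move=> K0 t0; apply/eqP; rewrite eq_le; apply/andP; split; last first.
  by apply: integral_ge0 => omega _; rewrite lee_fin sqr_ge0.
apply/lee_addgt0Pr => eta eta0; rewrite add0e.
have L1 : 0 < L K ^+ 2 + 1 by rewrite ltr_wpDl// sqr_ge0.
have cv : exp_coeff (C * t) @ \oo --> (0 : R).
  exact: cvg_series_cvg_0 (is_cvg_series_exp_coeff _).
have eL : 0 < eta / (L K ^+ 2 + 1) by rewrite divr_gt0.
move/cvgrPdist_lt : cv => /(_ _ eL) [N _ /(_ N (leqnn N))].
rewrite sub0r normrN /exp_coeff => hN.
apply: (le_trans (sq_diff_factorial N K0 t0)); rewrite lee_fin -mulrA.
have h1 := le_lt_trans (ler_norm _) hN.
apply: (@le_trans _ _ (L K ^+ 2 * (eta / (L K ^+ 2 + 1)))).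
  by rewrite ler_wpM2l ?sqr_ge0// ltW.
rewrite mulrCA ler_piMr ?(ltW eta0)// ler_pdivrMr// mul1r.
by rewrite lerDl.
Qed.

Lemma linear_sde_solution t : 0 <= t ->
  measurable [set omega | S t omega != s * exp_brownian B a t omega] /\
  P [set omega | S t omega != s * exp_brownian B a t omega] = 0%E.
Proof.
move=> t0; set N := [set omega | _].
have mX : measurable_fun setT (fun omega => S t omega - s * exp_brownian B a t omega).
  apply: measurable_funB; first exact: measurable_S.
  by apply: measurable_funM => //; exact: measurable_exp_brownian.
have mN : measurable N.
  rewrite (_ : N = ~` ((fun omega => S t omega - s * exp_brownian B a t omega) @^-1` [set 0])).
    apply: measurableC; rewrite -[X in measurable X]setTI; exact: mX (measurable_set1 0).
  apply/seteqP; split => omega /=; rewrite /N/= -subr_eq0 => /eqP//.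
split => //.
(* One integer serves as path bound and as inverse threshold: it is taken above both path bounds and
   the inverse of the nonzero difference, so countably many null events cover [N]. *)
pose V (K : nat) := [set omega | K.+1%:R^-1 <= `|stopped_diff B a s S K.+1%:R t omega|].
have mV K : measurable (V K).
  rewrite -[V K]setTI.
  rewrite (_ : V K = (fun omega => `|stopped_diff B a s S K.+1%:R t omega|) @^-1`
     `[K.+1%:R^-1, +oo[%classic); last first.
    by apply/seteqP; split => z /=; rewrite in_itv/= andbT.
  by apply: (measurableT_comp (@normr_measurable _ setT)) => //; exact: measurable_stopped_diff.
have PV K : P (V K) = 0%E.
  have K0 : 0 < K.+1%:R :> R by [].
  apply/eqP; rewrite eq_le measure_ge0 andbT.
  have iK0 : 0 < K.+1%:R^-1 :> R by rewrite invr_gt0.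
  apply: (le_trans (sqr_chebyshev P iK0 (measurable_stopped_diff _ t0))).
  by rewrite -/(sq_diff P B a s S K.+1%:R t) sq_diff_eq0// mule0.
have NV : N `<=` \bigcup_K V K.
  move=> omega; rewrite /N/= -subr_eq0 => Nomega.
  have [K1 hK1] := path_bounded (sde_continuous hS (omega := omega)) t0.
  have [K2 hK2] := path_bounded (exp_brownian_continuous hB (a := a) (omega := omega)) t0.
  set y := S t omega - s * exp_brownian B a t omega in Nomega.
  have y0 : 0 < `|y| by rewrite normr_gt0.
  pose K := Num.truncn (`|K1| + `|K2| + `|y|^-1).
  have hK : `|K1| + `|K2| + `|y|^-1 < K.+1%:R.
    have h0 : 0 <= `|K1| + `|K2| + `|y|^-1 by rewrite !addr_ge0.
    by have /andP[] := truncn_itv h0.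
  have k1 := normr_ge0 K1; have k2 := normr_ge0 K2; have k3 := ler_norm K1.
  have k4 := ler_norm K2.
  have iy0 : 0 < `|y|^-1 by rewrite invr_gt0.
  exists K => //; rewrite /V/= /stopped_diff indicE mem_set ?mulr1 -/y.
    by rewrite invf_ple ?posrE//; lra.
  split => r rt; first by apply: le_trans (hK1 r rt) _; lra.
  by apply: le_trans (ler_norm _) (le_trans (hK2 r rt) _); lra.
have : P.-negligible N.
  apply: negligibleS NV _; apply: negligible_bigcup => K.
  by exists (V K); split => //; exact: PV.
by move=> /(measure_negligible mN).
Qed.

(** Lenglart's inequality on the single cell [0, T] with coefficient 1 and [delta = T]: the
    quadratic sum is exactly T, so the exceptional event is empty. *)
Lemma brownian_tail T eps : 0 < T -> 0 < eps ->
  (P [set omega | (eps <= `|B T omega - B 0 omega|)%R] <=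
   (eps ^- 2 * (2 * expR 8 * T))%:E)%E.
Proof.
move=> T0 eps0; pose t (i : nat) := i%:R * T.
have t0 : t 0%N = 0 by rewrite /t mul0r.
have tlt i : (i < 1)%N -> t i < t i.+1 by move=> _; rewrite ltr_pM2r// ltr_nat.
have hk i : (i < 1)%N -> measurable_wrt (F (t i)) (fun=> 1 : R).
  move=> i1; have sG := filtration_sigma_algebra hF (grid_ge0 t0 tlt (ltnW i1)).
  by apply/(measurable_wrtP _ sG); exact: measurable_cst.
have := lenglart hF hB t0 tlt hk eps0 T0.
rewrite (_ : [set omega | (T < _)%R] = set0) ?measure0 ?add0e; last first.
  by apply/seteqP; split => omega //=; rewrite big_ord1 /t expr1n mul1r !mul1r mul0r subr0 ltxx.
by under eq_set do rewrite big_ord1 /t mul1r mul1r mul0r.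
Qed.

Hypotheses (s0 : 0 < s) (a0 : a != 0).

Lemma measurable_small l t : 0 <= t -> measurable [set omega | 0 < S t omega <= l].
Proof.
move=> t0; rewrite -[X in measurable X]setTI.
rewrite (_ : [set omega | _] = S t @^-1` `]0, l]%classic); first exact: measurable_S.
by apply/seteqP; split => omega /=; rewrite in_itv.
Qed.

(** Positivity is part of the event because the payoff is assumed monotone only at positive
    arguments. *)
Lemma linear_sde_small (l eta : R) : 0 < l -> 0 < eta ->
  exists2 T0 : R, 0 < T0 & forall T, T0 <= T ->
    ((1 - eta)%:E <= P [set omega | (0 < S T omega <= l)%R])%E.
Proof.
move=> l0 eta0.
have a20 : 0 < a ^+ 2 by rewrite exprn_even_gt0.
(* If |B_T| < |a| T / 4, the exponent of E_T is at most -a^2 T / 4, which is below ln(l / s) once T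
   >= T1; the complementary event has probability at most 32 e^8 / (a^2 T), which is at most eta
   once T >= T2. *)
pose T1 := 4 * `|ln (l / s)| / a ^+ 2.
pose T2 := 32 * expR 8 / (a ^+ 2 * eta).
have T10 : 0 <= T1 by rewrite divr_ge0 ?(ltW a20)// mulr_ge0.
have T20 : 0 < T2.
  by apply: divr_gt0; apply: mulr_gt0 => //; exact: expR_gt0.
exists (T1 + T2 + 1); first by rewrite ltr_wpDl// addr_ge0// ltW.
move=> T hT; have T0 : 0 < T by lra.
have hT1 : T1 <= T by lra.
have hT2 : T2 <= T by lra.
have [mN PN] := linear_sde_solution (ltW T0).
have [mB0 PB0] := probability_neq (measurable_B (lexx 0)) (brownian_start hB).
pose eps := `|a| * T / 4.
have eps0 : 0 < eps by rewrite divr_gt0// mulr_gt0// normr_gt0.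
set A := [set omega | _].
have mA : measurable A by apply: measurable_small; exact: ltW.
set N := [set omega | _] in mN PN; set N0 := [set omega | _] in mB0 PB0.
pose V := [set omega | eps <= `|B T omega - B 0 omega|].
have mV : measurable V.
  rewrite -[V]setTI.
  rewrite (_ : V = (fun omega => `|B T omega - B 0 omega|) @^-1` `[eps, +oo[%classic).
    apply: (measurableT_comp (@normr_measurable _ setT)) => //.
    by apply: measurable_funB; apply: measurable_B => //; exact: ltW.
  by apply/seteqP; split => z /=; rewrite in_itv/= andbT.
have sub : ~` A `<=` (N `|` N0) `|` V.
  move=> omega nA; apply: contrapT => /not_orP[/not_orP[hN hN0] hV]; apply: nA.
  have {hN}hN : S T omega = s * exp_brownian B a T omega.
    by apply/eqP/negPn/negP.
  have {hN0}hN0 : B 0 omega = 0 by apply/eqP/negPn/negP.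
  have {hV} : `|B T omega| < eps.
    by rewrite ltNge; apply/negP => h; apply: hV; rewrite /V/= hN0 subr0.
  move=> hV; rewrite /A/= hN; apply/andP; split.
    by rewrite mulr_gt0// expR_gt0.
  rewrite mulrC -ler_pdivlMr// -[leRHS]lnK ?posrE ?divr_gt0// /exp_brownian ler_expR.
  have h1 : a * B T omega <= a ^+ 2 * T / 4.
    apply: le_trans (ler_norm _) _; rewrite normrM -(real_normK (num_real a)) expr2.
    by rewrite -!mulrA ler_wpM2l// mulrA ltW.
  have h2 : - ln (l / s) <= a ^+ 2 * T / 4.
    apply: le_trans (ler_norm _) _; rewrite normrN.
    by move: hT1; rewrite /T1 ler_pdivrMr//; lra.
  lra.
have PA : (P (~` A) <= eta%:E)%E.
  apply: (@le_trans _ _ (P ((N `|` N0) `|` V))).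
    apply: le_measure => //; rewrite inE; first exact: measurableC.
    by apply: measurableU => //; exact: measurableU.
  rewrite -[leRHS]add0e; apply: measureU_le => //; first exact: measurableU.
    by rewrite -[leRHS]adde0; apply: measureU_le => //; [rewrite PN|rewrite PB0].
  apply: (le_trans (brownian_tail T0 eps0)); rewrite lee_fin.
  have -> : eps ^- 2 * (2 * expR 8 * T) = 32 * expR 8 / (a ^+ 2 * T).
    rewrite /eps expr_div_n exprMn real_normK ?num_real//.
    by field; rewrite a0 gt_eqF.
  rewrite ler_pdivrMr; last exact: (mulr_gt0 a20 T0).
  have -> : eta * (a ^+ 2 * T) = a ^+ 2 * eta * T by ring.
  have ae0 : 0 < a ^+ 2 * eta by exact: (mulr_gt0 a20 eta0).
  by move: hT2; rewrite /T2 (ler_pdivrMr _ _ ae0) [leRHS]mulrC.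
have fA : P (~` A) \is a fin_num by apply: fin_num_measure; exact: measurableC.
have := probability_setC P (measurableC mA); rewrite setCK => ->.
by rewrite EFinB; apply: leeB.
Qed.

End explicit_solution.

(** * The objective and the payoff *)

Section choquet.
Context {R : realType} {d : measure_display} {Omega : measurableType d}.
Variables (P : probability Omega R) (w : R -> R).
Hypothesis hw : is_distortion w.
Local Notation mu := (@lebesgue_measure R).

Lemma distortion_le p q : 0 <= p -> p <= q -> q <= 1 -> w p <= w q.
Proof.
move=> p0 pq q1; have [->//|pq'] := eqVneq p q.
apply/ltW/(distortion_increasing hw); rewrite ?in_itv/= ?p0 ?q1 ?andbT/=.
- exact: le_trans pq q1.
- exact: le_trans p0 pq.
- by rewrite lt_neqAle pq'.
Qed.

(** Left continuity at 1: absolute continuity applied to the single interval ]p, 1[. *)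
Lemma distortion_near1 eps : 0 < eps -> exists2 delta, 0 < delta &
  forall p, 0 <= p <= 1 -> 1 - delta < p -> 1 - eps < w p.
Proof.
move=> eps0; have [delta delta0 h] := distortion_absolutely_continuous hw eps0.
exists delta => // p /andP[p0 p1] pd.
have := h 1%N (fun=> p) (fun=> 1); rewrite !big_ord1 => {}h.
have : `|w 1 - w p| < eps.
  apply: h; first by move=> _ _; split.
    move=> i j /= i1 j1 _.
    by move: i1 j1; rewrite /mkset/= !ltnS !leqn0 => /eqP -> /eqP ->.
  by lra.
by rewrite (distortion1 hw) => /(le_lt_trans (ler_norm _)); lra.
Qed.

Variable Z : Omega -> R.
Hypothesis mZ : measurable_fun setT Z.

Definition distorted_tail (x : R) : R :=
  w (fine (P [set omega | (x < Z omega)%R])).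

Definition choquet : \bar R :=
  (\int[mu]_(x in `[0%R, +oo[) (distorted_tail x)%:E)%E.

Lemma measurable_gt x : measurable [set omega | x < Z omega].
Proof.
rewrite -[X in measurable X]setTI.
rewrite (_ : [set omega | _] = Z @^-1` `]x, +oo[%classic); first exact: mZ.
by apply/seteqP; split => omega /=; rewrite in_itv/= andbT.
Qed.

Lemma fine_prob_itv (A : set Omega) : measurable A -> 0 <= fine (P A) <= 1.
Proof.
move=> mA; have fA : P A \is a fin_num by exact: fin_num_measure.
by rewrite -!lee_fin fineK// measure_ge0 probability_le1.
Qed.

Lemma fine_prob_le (A C : set Omega) : measurable A -> measurable C ->
  A `<=` C -> fine (P A) <= fine (P C).
Proof.
move=> mA mC AC; apply: fine_le; [exact: fin_num_measure|exact: fin_num_measure|].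
by apply: le_measure; rewrite ?inE.
Qed.

Lemma distorted_tail_itv x : 0 <= distorted_tail x <= 1.
Proof. by apply: (distortion_range hw); exact/fine_prob_itv/measurable_gt. Qed.

Lemma distorted_tail_nonincreasing x y : x <= y ->
  distorted_tail y <= distorted_tail x.
Proof.
move=> xy; have /andP[h0 _] := fine_prob_itv (measurable_gt y).
have /andP[_ h1] := fine_prob_itv (measurable_gt x).
apply: distortion_le => //; apply: fine_prob_le; try exact: measurable_gt.
by move=> omega /=; exact: le_lt_trans.
Qed.

Lemma measurable_distorted_tail D : measurable D ->
  measurable_fun D (fun x => (distorted_tail x)%:E).
Proof.
move=> mD; apply/measurable_EFinP; apply: nonincreasing_measurable => //.
by move=> x y; exact: distorted_tail_nonincreasing.
Qed.

Lemma choquet_ge (p c : R) : 0 <= p -> 0 <= c ->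
  (forall x, 0 <= x < c -> p <= distorted_tail x) -> ((p * c)%:E <= choquet)%E.
Proof.
move=> p0 c0 h.
apply: (@le_trans _ _ (\int[mu]_(x in `[0%R, c[) p%:E)%E).
  rewrite integral_cst//= lebesgue_measure_itv/= lte_fin.
  case: ltP => [_|c00]; first by rewrite sube0 EFinM.
  by rewrite mule0 lee_fin (_ : c = 0) ?mulr0//; apply/eqP; rewrite eq_le c00 c0.
apply: (@le_trans _ _ (\int[mu]_(x in `[0%R, c[) (distorted_tail x)%:E)%E).
  by apply: ge0_le_integral => //; exact: measurable_distorted_tail.
apply: ge0_subset_integral => //.
- exact: measurable_distorted_tail.
- by move=> x _; rewrite lee_fin; have /andP[] := distorted_tail_itv x.
- by move=> x /=; rewrite !in_itv/= andbT => /andP[].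
Qed.

(** The tail lies under the step function equal to 1 on [0, y[, [q] on [y, r[ and 0 beyond. *)
Lemma choquet_le (y r q : R) : 0 <= y -> y <= r -> 0 <= q ->
  (forall x, y <= x -> distorted_tail x <= q) ->
  (forall x, r <= x -> distorted_tail x <= 0) ->
  (choquet <= (y + q * (r - y))%:E)%E.
Proof.
move=> y0 yr q0 hq h0.
have mi (a b : R) D : measurable D -> measurable_fun D (fun x => (\1_`[a, b[ x : R)%:E).
  move=> mD; apply/measurable_EFinP/measurable_funTS; exact: measurable_indic.
have leb (a b : R) : 0 <= a -> a <= b ->
    (\int[mu]_(x in `[0%R, +oo[) (\1_`[a, b[ x : R)%:E = (b - a)%:E)%E.
  move=> a0 ab; rewrite integral_indic// setIidl; last first.
    by move=> x /=; rewrite !in_itv/= andbT => /andP[/(le_trans a0)].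
  rewrite /= lebesgue_measure_itv/= lte_fin; case: ltP => [_|ba]; first by rewrite -EFinB.
  by rewrite (_ : b = a) ?subrr//; apply/eqP; rewrite eq_le ba ab.
apply: (@le_trans _ _ (\int[mu]_(x in `[0%R, +oo[)
   ((\1_`[0%R, y[ x)%:E + q%:E * (\1_`[y, r[ x)%:E))%E).
  apply: ge0_le_integral => //.
  - by move=> x _; rewrite lee_fin; have /andP[] := distorted_tail_itv x.
  - exact: measurable_distorted_tail.
  - by apply: emeasurable_funD; [exact: mi|apply: emeasurable_funM => //; exact: mi].
  - move=> x /=; rewrite in_itv/= andbT => x0; rewrite -EFinM -EFinD lee_fin.
    have [xy|yx] := ltP x y.
      rewrite [X in X + _]indicE mem_set/= ?in_itv/= ?x0//.
      have /andP[_ h1] := distorted_tail_itv x.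
      by rewrite (le_trans h1)// lerDl mulr_ge0.
    have [xr|rx] := ltP x r.
      rewrite [X in q * X]indicE mem_set/= ?in_itv/= ?yx// mulr1.
      by rewrite (le_trans (hq _ yx))// lerDr.
    by rewrite (le_trans (h0 _ rx))// addr_ge0// mulr_ge0.
rewrite ge0_integralD//; last 3 first.
- exact: mi.
- by move=> x _; rewrite -EFinM lee_fin mulr_ge0.
- by apply: emeasurable_funM => //; exact: mi.
rewrite ge0_integralZl_EFin//; last exact: mi.
by rewrite !leb// subr0 -EFinM -EFinD.
Qed.

Lemma choquet_le_bound (r : R) : 0 <= r -> (forall omega, Z omega <= r) ->
  (choquet <= r%:E)%E.
Proof.
move=> r0 Zr.
have := @choquet_le r r 0 r0 (lexx r) (lexx 0).
rewrite mul0r addr0; apply;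
  move=> x rx; rewrite /distorted_tail (_ : [set omega | _] = set0);
  rewrite ?measure0 ?(distortion0 hw)//;
  by apply/seteqP; split => omega //=; rewrite ltNge (le_trans (Zr omega)).
Qed.

(** P(Z > r - r / (n+1)) tends to 0, so it is below 1/2 at some level y < r. Above y the distorted
    tail is at most w(1/2) < 1, by strict monotonicity, which loses at least (1 - w(1/2)) (r -
    y). *)
Lemma choquet_lt_bound (r : R) : (forall omega, 0 <= Z omega < r) ->
  (choquet < r%:E)%E.
Proof.
move=> Zr; have r0 : 0 < r by have /andP[] := Zr point; exact: le_lt_trans.
pose y (n : nat) := r - r / n.+1%:R.
have y0 n : 0 <= y n.
  by rewrite subr_ge0 ler_pdivrMr// ler_peMr ?(ltW r0)// ler1n.
have yr n : y n < r by rewrite ltrBlDr ltrDl divr_gt0.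
have half0 : 0 < 2^-1 :> R by rewrite invr_gt0.
have [] := @prob_eventually_outside _ _ _ P (fun n => [set omega | y n < Z omega])
   2^-1 _ _ half0.
- by move=> n; exact: measurable_gt.
- move=> omega; have /andP[_ Zo] := Zr omega.
  have e0 : 0 < (r - Z omega) / r by rewrite divr_gt0// subr_gt0.
  have ie0 : 0 <= ((r - Z omega) / r)^-1 by rewrite invr_ge0 ltW.
  exists (Num.truncn ((r - Z omega) / r)^-1).+1 => n hn /=; apply/negP.
  have /andP[_ h1] := truncn_itv ie0.
  have h2 : ((r - Z omega) / r)^-1 <= n.+1%:R.
    by rewrite (le_trans (ltW h1))// ler_nat (leq_trans hn).
  rewrite -leNgt /y lerBrDr addrC -lerBrDr.
  rewrite ler_pdivrMr// mulrC -ler_pdivrMr ?subr_gt0//.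
  by move: h2; rewrite invf_div.
move=> N /(_ N (leqnn N)) hN.
pose q := w 2^-1.
have q1 : q < 1.
  rewrite -(distortion1 hw); apply: (distortion_increasing hw).
  - by rewrite in_itv/= ltW//= invf_le1// ler1n.
  - by rewrite in_itv/= ler01 lexx.
  - by rewrite invf_lt1// ltr1n.
have q0 : 0 <= q.
  have h : 0 <= (2^-1 : R) <= 1 by rewrite ltW//= invf_le1// ler1n.
  by have /andP[] := distortion_range hw h.
apply: (@le_lt_trans _ _ (y N + q * (r - y N))%:E).
  apply: choquet_le => //; first exact: ltW.
  - move=> x yx; apply: le_trans (distorted_tail_nonincreasing yx) _.
    have /andP[h1 h2] := fine_prob_itv (measurable_gt (y N)).
    apply: distortion_le => //; last by rewrite invf_le1// ler1n.
    rewrite -lee_fin fineK ?ltW//; apply: fin_num_measure; exact: measurable_gt.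
  - move=> x rx; rewrite /distorted_tail (_ : [set omega | _] = set0);
      rewrite ?measure0 ?(distortion0 hw)//.
    apply/seteqP; split => omega //=; have /andP[_ Zo] := Zr omega.
    by rewrite ltNge (le_trans (ltW Zo)).
rewrite lte_fin; have := yr N; move: (y N) => z zr.
have : 0 < (1 - q) * (r - z) by rewrite mulr_gt0 ?subr_gt0.
by lra.
Qed.

End choquet.

(** * The payoff and its limit at 0 *)

Section payoff.
Context {R : realType}.
Variables (U : R -> R) (beta : R).
Hypotheses (hU : is_payoff U) (beta0 : beta != 0).
Local Notation u := (transformed_payoff U beta).

Lemma transformed_payoff_ge0 x : 0 <= u x.
Proof. by apply: (payoff_ge0 hU); exact: powR_ge0. Qed.

Lemma measurable_transformed_payoff : measurable_fun setT u.
Proof.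
rewrite (_ : u = U \o (fun x => x `^ beta^-1))//.
have mU : measurable_fun (`[0, +oo[%classic : set R) U.
  by apply: subspace_continuous_measurable_fun => //; exact: payoff_continuous hU.
apply: (measurable_comp _ _ mU (@measurable_powR R beta^-1)) => //.
by move=> _ [x _ <-] /=; rewrite in_itv/= powR_ge0.
Qed.

Hypothesis decr : forall x y : R, 0 < x -> x <= y -> u y <= u x.

(* At 0 and at negative x, where it is junk, u x is U 0 and u 1. *)
Lemma transformed_payoff_dominated x : exists2 y, 0 < y & u x <= u y.
Proof.
have [x0|x0|->] := ltgtP x 0.
- exists 1 => //; rewrite /transformed_payoff powR1 /powR lt_eqF//.
  by rewrite ln0 ?(ltW x0)// mulr0 expR0.
- by exists x.
- exists 1 => //; rewrite /transformed_payoff powR1 powR0 ?invr_eq0//.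
  by apply: (payoff_nondecreasing hU); rewrite ?in_itv/= ?lexx ?ler01.
Qed.

Lemma right_limit0E :
  right_limit0 u = ereal_sup ((EFin \o u) @` `]0, +oo[%classic).
Proof.
apply: cvg_lim => //; apply: nonincreasing_at_right_cvge => //.
move=> x y; rewrite !in_itv/= !andbT => x0 y0 xy; rewrite lee_fin.
exact: decr.
Qed.

(** Holding at every real x, it bounds u(S_tau) path by path, including the null event where [S] is
    not positive. *)
Lemma transformed_payoff_le_right_limit0 x : ((u x)%:E <= right_limit0 u)%E.
Proof.
have [y y0 uy] := transformed_payoff_dominated x.
apply: (@le_trans _ _ (u y)%:E); first by rewrite lee_fin.
by rewrite right_limit0E; apply: ereal_sup_ubound; exists y => //=; rewrite in_itv/= y0.
Qed.

Lemma lt_right_limit0 (c : \bar R) : (c < right_limit0 u)%E ->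
  exists2 l, 0 < l & (c < (u l)%:E)%E.
Proof.
rewrite right_limit0E => /ereal_sup_gt[_ [l + <-] cl].
by rewrite /= in_itv/= andbT => l0; exists l.
Qed.

End payoff.

(** * Stopping times *)

Section stopping.
Context {R : realType} {d : measure_display} {Omega : measurableType d}.
Variable P : probability Omega R.
Variables (F : R -> set (set Omega)) (S : R -> Omega -> R).
Implicit Types t r T : R.
Hypotheses (hF : is_filtration F) (aS : adapted F S) (cS : continuous_paths S).

Lemma measurable_finite_time (tau : Omega -> \bar R) :
  (forall t : R, 0 <= t -> measurable [set omega | (tau omega <= t%:E)%E]) ->
  measurable [set omega | (tau omega < +oo)%E].
Proof.
move=> h; rewrite (_ : [set omega | _] = \bigcup_n [set omega | (tau omega <= n%:R%:E)%E]).
  by apply: bigcup_measurable => n _; exact: h.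
apply/seteqP; split => omega /=.
  case E : (tau omega) => [r| //|] _; last by exists 0%N => //=; rewrite E leNye.
  exists (Num.truncn `|r|).+1 => //=; rewrite E lee_fin (le_trans (ler_norm _))//.
  by have /andP[_ /ltW] := truncn_itv (normr_ge0 r).
by move=> [n _ /= hn]; rewrite (le_lt_trans hn)// ltry.
Qed.

Lemma measurable_fine_stopping (tau : Omega -> \bar R) :
  stopping_times P F tau -> measurable_fun setT (fine \o tau).
Proof.
move=> [tau0 htau _].
have mle t : 0 <= t -> measurable [set omega | (tau omega <= t%:E)%E].
  by move=> t0; apply: (filtration_measurable hF t0); exact: htau.
have moo := measurable_finite_time mle.
apply: (measurability (@RGenOInfty.G R)) => [|/= _ [_] [c] -> <-].
  exact: RGenOInfty.measurableE.
rewrite setTI; have [c0|c0] := ltP c 0.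
  rewrite (_ : _ @^-1` _ = setT); first exact: measurableT.
  apply/seteqP; split => omega //= _; rewrite in_itv/= andbT.
  by rewrite (lt_le_trans c0)// fine_ge0.
(* [fine] sends +oo to 0, so the paths with infinite [tau] must be removed when c >= 0. *)
rewrite (_ : _ @^-1` _ = ~` [set omega | (tau omega <= c%:E)%E] `&`
    [set omega | (tau omega < +oo)%E]).
  by apply: measurableI => //; apply: measurableC; exact: mle.
apply/seteqP; split => omega /=; rewrite in_itv/= andbT; have := tau0 omega.
  case: (tau omega) => [r| |]//= r0 cr; last by rewrite ltNge c0 in cr.
  by split; [apply/negP; rewrite -ltNge lte_fin|rewrite ltry].
move=> tau00 [/negP]; rewrite -ltNge.
by case: (tau omega) tau00 => [r| |]//=; rewrite lte_fin.
Qed.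

Lemma measurable_stopped (tau : Omega -> \bar R) :
  stopping_times P F tau -> measurable_fun setT (stopped S tau).
Proof.
move=> htau; have mtau := measurable_fine_stopping htau.
have mS := measurable_path (fun q q_ge0 => adapted_measurable hF aS q_ge0) cS.
have mp : measurable_fun setT
    (fun omega => (omega, (fine (tau omega) : measurableTypeR R))).
  exact: measurable_fun_pair.
have := measurableT_comp mS mp; congr (measurable_fun _ _).
apply/funext => omega; rewrite /stopped/= max_r//.
by have [tau0 _ _] := htau; exact: fine_ge0.
Qed.

Lemma deterministic_stopping (T : R) : 0 <= T -> stopping_times P F (fun=> T%:E).
Proof.
move=> T0; split; first by move=> _; rewrite lee_fin.
  move=> t t0; have sG := filtration_sigma_algebra hF t0.
  rewrite -[F t](sigma_algebra_id sG).
  have [Tt|tT] := leP T t.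
    rewrite (_ : [set _ | _] = setT); last first.
      by apply/seteqP; split => omega //= _; rewrite lee_fin.
    exact: (@measurableT _ (g_sigma_algebraType (F t))).
  rewrite (_ : [set _ | _] = set0); last first.
    by apply/seteqP; split => omega //=; rewrite lee_fin leNgt tT.
  exact: (@measurable0 _ (g_sigma_algebraType (F t))).
rewrite (_ : [set _ | _] = setT) ?probability_setT//.
by apply/seteqP; split => omega //= _; rewrite ltry.
Qed.

Variable l : R.
Local Notation tau := (hitting_time S l).

Lemma hitting_time_ge0 omega : (0 <= tau omega)%E.
Proof. by apply: le_ereal_inf_tmp => _ [t [t0 _] <-]; rewrite lee_fin. Qed.

Lemma hitting_time_le (t : R) omega : 0 <= t -> S t omega <= l ->
  (tau omega <= t%:E)%E.
Proof. by move=> t0 St; apply: ereal_inf_lbound; exists t. Qed.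

Lemma path_min (t : R) omega : 0 <= t ->
  exists2 c, 0 <= c <= t & forall r : R, 0 <= r <= t -> S c omega <= S r omega.
Proof.
move=> t0; have c1 : {within `[0, t], continuous (S ^~ omega)}.
  apply: continuous_subspaceW (@cS omega) => r.
  by rewrite /= !in_itv/= => /andP[-> _].
have [c ct hc] := EVT_min t0 c1; exists c; first by rewrite in_itv in ct.
by move=> r rt; apply: hc; rewrite in_itv.
Qed.

(** The infimum is attained: a path above [l] on [0, t] stays above [l] for a further [delta], which
    pushes [tau] beyond t. *)
Lemma hitting_time_leP (t : R) omega : 0 <= t ->
  (tau omega <= t%:E)%E <-> exists2 r, 0 <= r <= t & S r omega <= l.
Proof.
move=> t0; split; last first.
  by move=> [r /andP[r0 rt] Sr]; rewrite (le_trans (hitting_time_le r0 Sr))// lee_fin.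
move=> taut; apply: contrapT => no.
have Sl r : 0 <= r <= t -> l < S r omega.
  by move=> rt; rewrite ltNge; apply/negP => Sr; apply: no; exists r.
have e0 : 0 < S t omega - l by rewrite subr_gt0 Sl// t0 lexx.
have [delta delta0 hd] := path_continuousP (@cS omega) t0 e0.
suff : ((t + delta)%:E <= tau omega)%E.
  by move=> /le_trans /(_ taut); rewrite lee_fin gerDl leNgt delta0.
apply: le_ereal_inf_tmp => _ [r [r0 Sr] <-]; rewrite lee_fin leNgt.
apply/negP => rtd; have [rt|tr] := leP r t.
  by have := Sl r; rewrite r0 rt => /(_ isT); rewrite ltNge Sr.
have : `|S r omega - S t omega| < S t omega - l.
  by apply: hd => //; rewrite gtr0_norm ?subr_gt0// ltrBlDl.
by rewrite distrC => /(le_lt_trans (ler_norm _)); lra.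
Qed.

(** Staying above [l] on [0, t] is an open condition, but a continuous path attains its minimum
    there, so it stays above l + 1/(n+1) for some n; each of these closed conditions is decided at
    time t. *)
Lemma hitting_time_adapted (t : R) : 0 <= t ->
  F t [set omega | (tau omega <= t%:E)%E].
Proof.
move=> t0; have sG := filtration_sigma_algebra hF t0.
pose E n := [set omega | forall r : R, 0 <= r <= t ->
  [set x | l + n.+1%:R^-1 <= x] (S r omega)].
have FE n : F t (E n) by apply: forall_path_adapted => //; exact: closed_ge.
have : measurable (~` (\bigcup_n E n) : set (g_sigma_algebraType (F t))).
  apply: measurableC; apply: bigcup_measurable => n _; exact: sub_sigma_algebra.
rewrite {1}/measurable/= sigma_algebra_id//.
congr (F t _); apply/seteqP; split => omega /=.
  move=> h; apply/hitting_time_leP => //; apply: contrapT => no; apply: h.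
  have [c ct hc] := path_min omega t0.
  have Sc : 0 < S c omega - l.
    by rewrite subr_gt0 ltNge; apply/negP => h; apply: no; exists c.
  have i0 : 0 <= (S c omega - l)^-1 by rewrite invr_ge0 ltW.
  exists (Num.truncn (S c omega - l)^-1) => // r rt /=.
  have /andP[_ h1] := truncn_itv i0.
  rewrite (le_trans _ (hc r rt))// -lerBrDl.
  by rewrite invf_ple ?posrE// ltW.
move=> /hitting_time_leP => /(_ t0) [r rt Sr] [n _ /(_ r rt)/=].
by apply/negP; rewrite -ltNge (le_lt_trans Sr)// ltrDl invr_gt0.
Qed.

(** If S_tau were below both S_0 and [l], the path would be below [l] slightly earlier. The lower
    bound keeps S_tau positive, where [u] is monotone. *)
Lemma stopped_hitting_time omega : (tau omega < +oo)%E ->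
  Num.min (S 0 omega) l <= stopped S tau omega <= l.
Proof.
have := hitting_time_ge0 omega; rewrite /stopped.
case E : (tau omega) => [r| |]//=; rewrite lee_fin => r0 _.
have rP := (hitting_time_leP omega r0).1; rewrite E lexx in rP.
have [r' /andP[r'0 r'r] Sr'] := rP isT.
have r'E : r' = r.
  apply/eqP; rewrite eq_le r'r/= -lee_fin -E; exact: hitting_time_le.
rewrite r'E in Sr'; rewrite Sr' andbT leNgt; apply/negP => Sr.
have [r00|rn0] := eqVneq r 0.
  by move: Sr; rewrite r00 lt_min ltxx.
have rp : 0 < r by rewrite lt_def rn0.
have e0 : 0 < Num.min (S 0 omega) l - S r omega by rewrite subr_gt0.
have [delta delta0 hd] := path_continuousP (@cS omega) r0 e0.
pose q := Num.max 0 (r - delta / 2).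
have q0 : 0 <= q by rewrite le_max lexx.
have qr : q < r by rewrite gt_max rp ltrBlDr ltrDl divr_gt0.
have qd : r - delta / 2 <= q by rewrite le_max lexx orbT.
have Sq : S q omega <= l.
  have : `|S q omega - S r omega| < Num.min (S 0 omega) l - S r omega.
    apply: hd => //; rewrite ltr0_norm ?subr_lt0//; lra.
  move=> /(le_lt_trans (ler_norm _)); rewrite ltrD2r lt_min => /andP[_].
  exact: ltW.
have := hitting_time_le q0 Sq; rewrite E lee_fin leNgt qr//.
Qed.

End stopping.

(** * Value, limit and attainment of the stopping problem *)

Unset Implicit Arguments.

Theorem theorem2p1 (R : realType) (d : measure_display)
  (Omega : measurableType d) (P : probability Omega R)
  (F : R -> set (set Omega)) (hF : is_filtration F)
  (B : R -> Omega -> R) (hB : is_brownian_motion P F B)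
  (sigma beta s : R) (hsigma : 0 < sigma) (hbeta : beta != 0) (hs : 0 < s)
  (S : R -> Omega -> R) (hS : solves_linear_sde P F B (beta * sigma) s S)
  (w : R -> R) (hw : is_distortion w)
  (U : R -> R) (hU : is_payoff U) :
  let u := transformed_payoff U beta in
  let J := objective P w u S in
  let V := optimal_value P F w u S in
  (forall x y : R, 0 < x -> x <= y -> u y <= u x) ->
  [/\ V = right_limit0 u,
      J (fun=> T%:E) @[T --> +oo%R] --> V,
      forall l : R, 0 < l -> (u l)%:E = right_limit0 u ->
        optimal_stopping P F w u S (hitting_time S l) &
      (forall l : R, 0 < l -> ((u l)%:E < right_limit0 u)%E) ->
        ~ exists tau : Omega -> \bar R, optimal_stopping P F w u S tau].
Proof.
move=> u J V decr.
have a0 : beta * sigma != 0 by rewrite mulf_neq0// gt_eqF.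
have aS := sde_adapted hS; have cS := sde_continuous hS.
have mu_ : measurable_fun setT u := measurable_transformed_payoff beta hU.
have mZ tau : stopping_times P F tau -> measurable_fun setT (u \o stopped S tau).
  by move=> htau; apply: measurableT_comp (measurable_stopped hF aS cS htau).
have JE tau : J tau = choquet P w (u \o stopped S tau) by [].
have u0ge0 : (0 <= right_limit0 u)%E.
  apply: le_trans (transformed_payoff_le_right_limit0 hU hbeta decr 1).
  by rewrite lee_fin transformed_payoff_ge0.
have Jle tau : stopping_times P F tau -> (J tau <= right_limit0 u)%E.
  move=> htau; rewrite JE.
  have ub omega := transformed_payoff_le_right_limit0 hU hbeta decr (stopped S tau omega).
  case E : (right_limit0 u) u0ge0 ub => [r| |]// r0 ub; last by rewrite leey.
  by apply: (choquet_le_bound P hw (mZ _ htau)) => // omega; rewrite -lee_fin; exact: ub.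
have Jge (c : R) : (c%:E < right_limit0 u)%E ->
    exists2 T0 : R, 0 < T0 & forall T, T0 <= T -> (c%:E <= J (fun=> T%:E))%E.
  move=> cu; have [c0|c0] := ltP c 0.
    exists 1 => // T T1; apply: (@le_trans _ _ 0%E); first by rewrite lee_fin ltW.
    have hT := deterministic_stopping P hF (le_trans ler01 T1).
    rewrite JE; have := choquet_ge hw (mZ _ hT) (lexx 0) (lexx 0).
    by rewrite mul0r; apply => x /andP[x0]; rewrite ltNge x0.
  have [l l0 cl] := lt_right_limit0 decr cu; rewrite lte_fin in cl.
  have ul0 : 0 < u l by exact: le_lt_trans cl.
  (* The distorted tail is to exceed c / u(l) on [0, u(l)[, which makes the objective at least c. *)
  have e0 : 0 < 1 - c / u l by rewrite subr_gt0 ltr_pdivrMr// mul1r.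
  have [delta delta0 hdelta] := distortion_near1 hw e0.
  have d20 : 0 < delta / 2 by rewrite divr_gt0.
  have [T0 T00 hT0] := linear_sde_small hF hB hS hs a0 l0 d20.
  exists T0 => // T T0T; have T1 : 0 <= T by rewrite (le_trans (ltW T00)).
  have hT := deterministic_stopping P hF T1.
  have mA := measurable_small hF hS l T1.
  set A := [set omega | _] in mA.
  have h1 : 1 - delta < fine (P A).
    rewrite -lte_fin fineK; last exact: fin_num_measure.
    apply: lt_le_trans (hT0 T T0T); rewrite lte_fin; lra.
  have h2 := hdelta _ (fine_prob_itv P mA) h1.
  have -> : c = c / u l * u l by rewrite divfK ?gt_eqF.
  rewrite JE; apply: (choquet_ge hw (mZ _ hT)).
  - by rewrite divr_ge0// ltW.
  - exact: ltW.
  - move=> x /andP[x0 xu].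
    have /andP[PA0 _] := fine_prob_itv P mA.
    have mG := measurable_gt (mZ _ hT) x.
    have /andP[_ PG1] := fine_prob_itv P mG.
    have AG : fine (P A) <= fine (P [set omega | (x < (u \o stopped S (fun=> T%:E)) omega)%R]).
      apply: fine_prob_le => // omega /= /andP[S0 Sl].
      by rewrite (lt_le_trans xu)//; exact: decr.
    apply: le_trans (distortion_le hw PA0 AG PG1).
    by apply: ltW; move: h2; lra.
have VE : V = right_limit0 u.
  apply/eqP; rewrite eq_le; apply/andP; split.
    by apply: ge_ereal_sup => _ [tau htau <-]; exact: Jle.
  rewrite leNgt; apply/negP => Vlt.
  have J0 : (0 <= V)%E.
    have h1 := deterministic_stopping P hF (@lexx _ _ (0 : R)).
    apply: le_trans (ereal_sup_ubound _); last by exists (fun=> 0%:E).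
    have := choquet_ge hw (mZ _ h1) (lexx 0) (lexx 0).
    by rewrite mul0r; apply => x /andP[x0]; rewrite ltNge x0.
  have [c Vc cu] : exists2 c : R, (V < c%:E)%E & (c%:E < right_limit0 u)%E.
    case E : V J0 Vlt => [v| |]// _; last by rewrite ltNge leey.
    case E' : (right_limit0 u) => [r| |]//.
      rewrite lte_fin => vr; exists ((v + r) / 2); rewrite lte_fin; lra.
    by move=> _; exists (v + 1); rewrite ?ltry// lte_fin ltrDl.
  have [T0 T00 /(_ T0 (lexx _)) cJ] := Jge c cu.
  have : (J (fun=> T0%:E) <= V)%E.
    by apply: ereal_sup_ubound; exists (fun=> T0%:E) => //; exact: (deterministic_stopping P hF (ltW T00)).
  by move=> /(le_trans cJ); rewrite leNgt Vc.
split => //.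
- rewrite VE; case E : (right_limit0 u) u0ge0 => [r| |]// _.
    (* Convergence to a real limit first requires J(T) to be eventually finite: it lies between r -
       1 and r. *)
    apply/fine_cvgP; split.
      have [T0 T00 hT0] : exists2 T0 : R, 0 < T0 &
          forall T, T0 <= T -> ((r - 1)%:E <= J (fun=> T%:E))%E.
        by apply: Jge; rewrite E lte_fin ltrBlDr ltrDl.
      near=> T.
      have T0T : T0 <= T by near: T; exact: nbhs_pinfty_ge (num_real _).
      have := Jle _ (deterministic_stopping P hF (le_trans (ltW T00) T0T)).
      have := hT0 T T0T; rewrite E; case: (J _) => //.
    apply/cvgrPdist_le => eps eps0.
    have [T0 T00 hT0] : exists2 T0 : R, 0 < T0 &
        forall T, T0 <= T -> ((r - eps)%:E <= J (fun=> T%:E))%E.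
      by apply: Jge; rewrite E lte_fin ltrBlDr ltrDl.
    near=> T.
    have T0T : T0 <= T by near: T; exact: nbhs_pinfty_ge (num_real _).
    have := Jle _ (deterministic_stopping P hF (le_trans (ltW T00) T0T)).
    have := hT0 T T0T; rewrite E /=; case: (J _) => [j| |]//.
    rewrite !lee_fin /= => h1 h2; rewrite ger0_norm ?subr_ge0//; lra.
  apply/cvgeyPge => A.
  have [T0 T00 hT0] : exists2 T0 : R, 0 < T0 &
      forall T, T0 <= T -> (A%:E <= J (fun=> T%:E))%E.
    by apply: Jge; rewrite E ltry.
  near=> T; apply: hT0; near: T; exact: nbhs_pinfty_ge (num_real _).
- move=> l l0 ul; set tau := hitting_time S l.
  have mle t : 0 <= t -> measurable [set omega | (tau omega <= t%:E)%E].
    move=> t0; apply: (filtration_measurable hF t0).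
    exact: (hitting_time_adapted hF aS cS l t0).
  have mfin := measurable_finite_time mle.
  (* A path with S_T <= l has hit by time T, and the probability of this can be brought arbitrarily
     close to 1. *)
  have Pfin : P [set omega | (tau omega < +oo)%E] = 1%E.
    apply/eqP; rewrite eq_le probability_le1//=.
    apply/lee_subgt0Pr => eps eps0.
    have [T0 T00 /(_ T0 (lexx _)) hT] := linear_sde_small hF hB hS hs a0 l0 eps0.
    apply: le_trans hT _; apply: le_measure; rewrite ?inE//.
      exact: (measurable_small hF hS l (ltW T00)).
    move=> omega /= /andP[_ Sl].
    by rewrite (le_lt_trans (hitting_time_le (ltW T00) Sl))// ltry.
  have htau : stopping_times P F tau.
    split => //; first by move=> omega; exact: hitting_time_ge0.
    by move=> t t0; exact: (hitting_time_adapted hF aS cS l t0).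
  split => //; last by rewrite -/V VE -ul ltry.
  apply/eqP; rewrite eq_le; apply/andP; split; first by rewrite -/V VE; exact: Jle.
  rewrite -/V VE -ul.
  have [mS0 PS0] := probability_neq (measurable_S hF hS (lexx 0)) (sde_start hS).
  have := choquet_ge hw (mZ _ htau) ler01 (transformed_payoff_ge0 beta hU l).
  rewrite mul1r; apply => x /andP[x0 xu].
  rewrite /distorted_tail (_ : fine _ = 1) ?(distortion1 hw)//.
  have mG := measurable_gt (mZ _ htau) x.
  rewrite (_ : P _ = 1%E)//; apply/eqP; rewrite eq_le probability_le1//=.
  set G := [set omega | _] in mG *; set N := [set omega | _] in mS0 PS0.
  (* When [tau] is finite and S_0 = s, S_tau lies in ]0, l], so its payoff is at least u(l) > x; the
     start fails only on the null event [N]. *)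
  apply: (@le_trans _ _ (P (G `|` N))).
    rewrite -[leLHS]Pfin; apply: le_measure; rewrite ?inE//; first exact: measurableU.
    move=> omega /= fo; have [S0|S0] := eqVneq (S 0 omega) s; [left|by right].
    have /andP[S1 S2] := stopped_hitting_time cS fo.
    apply: (lt_le_trans xu); apply: decr => //; apply: lt_le_trans S1.
    by rewrite S0 lt_min hs.
  by rewrite -[leRHS]adde0; apply: measureU_le => //; rewrite PS0.
- move=> strict [tau [htau Jopt Vfin]].
  move: Jopt Vfin; rewrite -/V -/(J tau) VE.
  (* An infinite value is excluded by the finiteness clause of [optimal_stopping]; only a real [r]
     remains. *)
  case E : (right_limit0 u) u0ge0 => [r| |]// _ Jr _.
  have : (choquet P w (u \o stopped S tau) < r%:E)%E.
    apply: (choquet_lt_bound P hw (mZ _ htau)) => omega.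
    rewrite transformed_payoff_ge0//=.
    have [y y0 uy] := transformed_payoff_dominated hU hbeta (stopped S tau omega).
    by rewrite (le_lt_trans uy)// -lte_fin -E; exact: strict.
  by rewrite -JE Jr ltxx.
Unshelve. all: by end_near. Qed.
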